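(* Let $(\mathfrak M,\mathcal H)$ be a (right) cocycle double cross coproduct pair over a field $k$, with distinguished character $\eta:\mathfrak M\to k$ and structure maps $\nabla,\blacktriangledown,\delta,\sigma$. Then the tensor product $\mathfrak M\otimes\mathcal H$ is a bialgebra through $$(x\otimes h)(x'\otimes h'):=xx'\otimes hh'$$ and $$\Delta(x\otimes h):=\big(x_{\{1\}}{h_{(1)}}^{\{1\}}\otimes x_{\{2\}<-1>}\,{h_{(1)}}^{\{2\}}{}_{<-1>}\,h_{(2)}{}^{[0]}\big)\otimes\big(x_{\{2\}<0>}\,{h_{(1)}}^{\{2\}}{}_{<0>}\,h_{(2)}{}^{[1]}\otimes h_{(3)}\big),$$ with the unit $1\otimes1\in\mathfrak M\otimes\mathcal H$ and the counit $x\otimes h\mapsto\eta(x)\varepsilon(h)$, if and only if the following hold for any $x\in\mathfrak M$ and any $h\in\mathcal H$: 1. $\eta(x_{\{1\}})x_{\{2\}}=x=x_{\{1\}}\eta(x_{\{2\}})$; 2. $\eta(h^{\{1\}})h^{\{2\}}=\varepsilon(h)1=h^{\{1\}}\eta(h^{\{2\}})$; 3. $\mathfrak M$ is a left $\mathcal H$-comodule via $\nabla$; 4. $x_{\{1\}}\otimes x_{\{2\}\{1\}}\otimes x_{\{2\}\{2\}}=x_{\{1\}\{1\}}\,(x_{\{2\}<-1>})^{\{1\}}\otimes x_{\{1\}\{2\}}\,(x_{\{2\}<-1>})^{\{2\}}\otimes x_{\{2\}<0>}$; 5. $x_{<-1>}\otimes x_{<0>\{1\}}\otimes x_{<0>\{2\}}=x_{\{1\}<-1>}\,(x_{\{2\}<-1>})^{[0]}\otimes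 x_{\{1\}<0>}\,(x_{\{2\}<-1>})^{[1]}\otimes x_{\{2\}<0>}$; 6. ${h_{(1)}}^{\{1\}}\otimes({h_{(1)}}^{\{2\}})_{\{1\}}\,{h_{(2)}}^{\{1\}}\otimes({h_{(1)}}^{\{2\}})_{\{2\}}\,{h_{(2)}}^{\{2\}}$ $=({h_{(1)}}^{\{1\}})_{\{1\}}\,\big(({h_{(1)}}^{\{2\}})_{<-1>}\big)^{\{1\}}\,\big({h_{(2)}}^{[0]}\big)^{\{1\}}\otimes({h_{(1)}}^{\{1\}})_{\{2\}}\,\big(({h_{(1)}}^{\{2\}})_{<-1>}\big)^{\{2\}}\,\big({h_{(2)}}^{[0]}\big)^{\{2\}}\otimes({h_{(1)}}^{\{2\}})_{<0>}\,{h_{(2)}}^{[1]}$; 7. ${h_{(1)}}^{[0]}\otimes({h_{(1)}}^{[1]})_{\{1\}}\,{h_{(2)}}^{\{1\}}\otimes({h_{(1)}}^{[1]})_{\{2\}}\,{h_{(2)}}^{\{2\}}$ $=({h_{(1)}}^{\{1\}})_{<-1>}\,\big(({h_{(1)}}^{\{2\}})_{<-1>}\big)^{[0]}\,\big({h_{(2)}}^{[0]}\big)^{[0]}\otimes({h_{(1)}}^{\{1\}})_{<0>}\,\big(({h_{(1)}}^{\{2\}})_{<-1>}\big)^{[1]}\,\big({h_{(2)}}^{[0]}\big)^{[1]}\otimes({h_{(1)}}^{\{2\}})_{<0>}\,{h_{(2)}}^{[1]}$; 8. ${h_{(1)}}^{[0]}\otimes({h_{(1)}}^{[1]})_{<-1>}\,{h_{(2)}}^{[0]}\otimes({h_{(1)}}^{[1]})_{<0>}\,{h_{(2)}}^{[1]}=(h^{[0]})_{(1)}\otimes(h^{[0]})_{(2)}\otimes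 h^{[1]}$; 9. $x_{<-1>}h^{[0]}\otimes x_{<0>}h^{[1]}=h^{[0]}x_{<-1>}\otimes h^{[1]}x_{<0>}$; 10. $h^{\{1\}}x_{\{1\}}\otimes h^{\{2\}}x_{\{2\}}=x_{\{1\}}h^{\{1\}}\otimes x_{\{2\}}h^{\{2\}}$.
   Context: Sweedler notation $\Delta(h)=h_{(1)}\otimes h_{(2)}$ is used for the comultiplication of $\mathcal H$, with counit $\varepsilon$; summations are suppressed throughout. A (right) cocycle double cross coproduct pair $(\mathfrak M,\mathcal H)$ consists of an algebra $\mathfrak M$ with a distinguished character (algebra homomorphism) $\eta:\mathfrak M\to k$, a bialgebra $\mathcal H$, and (unital) algebra homomorphisms, for the tensor product algebra structures, $$\nabla:\mathfrak M\to\mathcal H\otimes\mathfrak M,\quad \nabla(x)=x_{<-1>}\otimes x_{<0>};\qquad \blacktriangledown:\mathcal H\to\mathcal H\otimes\mathfrak M,\quad \blacktriangledown(h)=h^{[0]}\otimes h^{[1]};$$ $$\delta:\mathfrak M\to\mathfrak M\otimes\mathfrak M,\quad \delta(x)=x_{\{1\}}\otimes x_{\{2\}};\qquad \sigma:\mathcal H\to\mathfrak M\otimes\mathfrak M,\quad \sigma(h)=h^{\{1\}}\otimes h^{\{2\}},$$ such that for all $x\in\mathfrak M$, $h\in\mathcal H$: $\varepsilon(x_{<-1>})x_{<0>}=x$; $\ h^{[0]}\eta(h^{[1]})=h$; $\ x_{<-1>}\eta(x_{<0>})=\eta(x)1$; $\ \varepsilon(h^{[0]})h^{[1]}=\varepsilon(h)1$;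 $\ \eta(h^{\{1\}})\eta(h^{\{2\}})=\varepsilon(h)$. Neither $\nabla$ nor $\blacktriangledown$ is a priori assumed coassociative, and $\delta$ is not a priori coassociative. Iterated subscripts/superscripts mean iterated application of the corresponding maps, e.g. $x_{\{2\}<-1>}\otimes x_{\{2\}<0>}=\nabla(x_{\{2\}})$, ${h_{(1)}}^{\{2\}}{}_{<-1>}\otimes{h_{(1)}}^{\{2\}}{}_{<0>}=\nabla({h_{(1)}}^{\{2\}})$. *)

(* Defs.v *)
(* MathComp, with mathcomp.classical for the quotient defining the tensor
   product. *)
From HB Require Import structures.
From mathcomp Require Import all_boot all_order all_algebra.
From mathcomp Require Import boolp classical_sets.

Set Implicit Arguments.
Unset Strict Implicit.
Unset Printing Implicit Defensive.

Import GRing.Theory.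
Local Open Scope ring_scope.
Local Open Scope quotient_scope.

Reserved Notation "x ⊗ y" (at level 45, left associativity).
Reserved Notation "\tsum_ ( a ⊗ b <- t ) E"
  (at level 69, a name, b name, E at level 69,
   format "'[hv' \tsum_ ( a  ⊗  b  <-  t ) '/ '  E ']'").

Notation bilin f := (bilinear_for *:%R *:%R f).

Lemma bilin_comp (k : fieldType) (V W U U' : lmodType k)
    (f : V -> W -> U) (g : U -> U') :
  bilin f -> linear g -> bilin (fun v w => g (f v w)).
Proof.
by move=> [fl fr] gl; split=> u a x y; rewrite ?fl ?fr gl.
Qed.

(* V ⊗ W is the quotient of the formal finite sums of pairs (v, w) that       *)
(* identifies two sums when no bilinear map tells them apart, i.e. the        *)
(* quotient forced by the universal property.                                 *)
Section TensorQuotient.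
Variables (k : fieldType) (V W : lmodType k).

Definition formal_eval (U : lmodType k) (f : V -> W -> U) (s : seq (V * W)) : U :=
  \sum_(p <- s) f p.1 p.2.

Definition formal_equiv (s t : seq (V * W)) : Prop :=
  forall (U : lmodType k) (f : V -> W -> U),
    bilin f -> formal_eval f s = formal_eval f t.

Definition formal_equivb : rel (seq (V * W)) := fun s t => `[< formal_equiv s t >].

Lemma formal_equivb_refl : reflexive formal_equivb.
Proof. by move=> s; apply/asboolP. Qed.

Lemma formal_equivb_sym : symmetric formal_equivb.
Proof.
by move=> s t; apply/asboolP/asboolP => st U f bf; rewrite st.
Qed.

Lemma formal_equivb_trans : transitive formal_equivb.
Proof.
by move=> s t u /asboolP ts /asboolP su; apply/asboolP=> U f bf; rewrite ts ?su.
Qed.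

Canonical formal_equivR :=
  EquivRel formal_equivb formal_equivb_refl formal_equivb_sym formal_equivb_trans.

Definition tensor : Type := {eq_quot formal_equivR}.
HB.instance Definition _ := Choice.on tensor.

(* Sweedler summation: t = \sum_i a_i ⊗ b_i is sent to \sum_i f a_i b_i, for  *)
(* a chosen decomposition of t. The choice is irrelevant when f is bilinear;  *)
(* see [tsum_formal] and [tsum_tens] below.                                   *)
Definition tsum (U : lmodType k) (f : V -> W -> U) (t : tensor) : U :=
  formal_eval f (repr (t : {eq_quot formal_equivR})).

Definition tclass (s : seq (V * W)) : tensor := \pi_({eq_quot formal_equivR}) s.

Lemma tsum_formal (U : lmodType k) (f : V -> W -> U) s :
  bilin f -> tsum f (tclass s) = formal_eval f s.
Proof.
move=> bf; rewrite /tsum /tclass.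
by case: piP => t /eqmodP /= /asboolP st; rewrite st.
Qed.

Lemma tensor_ext (x y : tensor) :
  (forall (U : lmodType k) (f : V -> W -> U), bilin f -> tsum f x = tsum f y) ->
  x = y.
Proof.
move=> xy; rewrite -[x]reprK -[y]reprK; apply/eqmodP/asboolP => U f bf.
exact: xy.
Qed.

Definition tzero : tensor := tclass [::].
Definition tadd (x y : tensor) : tensor :=
  tclass (repr (x : {eq_quot formal_equivR}) ++ repr (y : {eq_quot formal_equivR})).
Definition tscale (a : k) (x : tensor) : tensor :=
  tclass [seq (a *: p.1, p.2) | p <- repr (x : {eq_quot formal_equivR})].
Definition topp (x : tensor) : tensor := tscale (-1) x.

Definition tens (v : V) (w : W) : tensor := tclass [:: (v, w)].

Section Tsum.
Variables (U : lmodType k) (f : V -> W -> U).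
Hypothesis bf : bilin f.

Lemma tsum_zero : tsum f tzero = 0.
Proof. by rewrite tsum_formal // /formal_eval big_nil. Qed.

Lemma tsum_add x y : tsum f (tadd x y) = tsum f x + tsum f y.
Proof. by rewrite tsum_formal // /formal_eval big_cat. Qed.

Lemma tsum_scale a x : tsum f (tscale a x) = a *: tsum f x.
Proof.
rewrite tsum_formal // /formal_eval big_map scaler_sumr.
apply: eq_bigr => p _ /=.
have [fl _] := bf.
have f0 : f 0 p.2 = 0.
  have := fl p.2 1 0 0; rewrite /= !scale1r addr0 => /eqP.
  by rewrite -subr_eq0 opprD addNKr oppr_eq0 => /eqP.
by have := fl p.2 a p.1 0; rewrite /= addr0 f0 addr0.
Qed.

Lemma tsum_opp x : tsum f (topp x) = - tsum f x.
Proof. by rewrite tsum_scale scaleN1r. Qed.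

Lemma tsum_tens v w : tsum f (tens v w) = f v w.
Proof. by rewrite tsum_formal // /formal_eval big_seq1. Qed.

End Tsum.

Lemma taddA : associative tadd.
Proof. by move=> x y z; apply: tensor_ext => U f bf; rewrite !tsum_add // addrA. Qed.
Lemma taddC : commutative tadd.
Proof. by move=> x y; apply: tensor_ext => U f bf; rewrite !tsum_add // addrC. Qed.
Lemma tadd0 : left_id tzero tadd.
Proof.
by move=> x; apply: tensor_ext => U f bf; rewrite !tsum_add // tsum_zero // add0r.
Qed.
Lemma taddN : left_inverse tzero topp tadd.
Proof.
move=> x; apply: tensor_ext => U f bf.
by rewrite !tsum_add // tsum_zero // tsum_opp // addNr.
Qed.

HB.instance Definition _ := GRing.isZmodule.Build tensor taddA taddC tadd0 taddN.

Lemma tscaleA a b (x : tensor) : tscale a (tscale b x) = tscale (a * b) x.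
Proof. by apply: tensor_ext => U f bf; rewrite !tsum_scale // scalerA. Qed.
Lemma tscale1 : left_id 1 tscale.
Proof. by move=> x; apply: tensor_ext => U f bf; rewrite !tsum_scale // scale1r. Qed.
Lemma tscaleDr : right_distributive tscale +%R.
Proof.
move=> a x y; apply: tensor_ext => U f bf.
by rewrite tsum_scale // !tsum_add // !tsum_scale // scalerDr.
Qed.
Lemma tscaleDl (x : tensor) : {morph tscale^~ x : a b / a + b}.
Proof.
move=> a b; apply: tensor_ext => U f bf.
by rewrite tsum_add // !tsum_scale // scalerDl.
Qed.

HB.instance Definition _ :=
  GRing.Zmodule_isLmodule.Build k tensor tscaleA tscale1 tscaleDr tscaleDl.

Lemma tsum_linear (U : lmodType k) (f : V -> W -> U) : bilin f -> linear (tsum f).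
Proof. by move=> bf a x y; rewrite tsum_add // tsum_scale. Qed.

Lemma tens_bilin : bilin tens.
Proof.
split=> [w|v] a x y; apply: tensor_ext => U f bf.
  by rewrite tsum_linear // !tsum_tens //; case: bf => -> _.
by rewrite tsum_linear // !tsum_tens //; case: bf => _ ->.
Qed.

Lemma tsum_sum (U : lmodType k) (f : V -> W -> U) I (r : seq I) (F : I -> tensor) :
  bilin f -> tsum f (\sum_(i <- r) F i) = \sum_(i <- r) tsum f (F i).
Proof.
by move=> bf; apply: (big_morph (tsum f)) => [x y|]; rewrite ?tsum_add ?tsum_zero.
Qed.

Lemma tsumE (U : lmodType k) (f : V -> W -> U) t :
  tsum f t = \sum_(p <- repr (t : {eq_quot formal_equivR})) f p.1 p.2.
Proof. by []. Qed.

Lemma tsum_id (t : tensor) : tsum tens t = t.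
Proof.
apply: tensor_ext => U f bf; rewrite [tsum tens t]tsumE tsum_sum //.
by apply: eq_bigr => p _; rewrite tsum_tens.
Qed.

(* uniqueness in the universal property *)
Lemma linear_ext (U : lmodType k) (f g : tensor -> U) :
  linear f -> linear g -> (forall v w, f (tens v w) = g (tens v w)) -> f =1 g.
Proof.
move=> fl gl fg t.
pose F := GRing.isLinear.Build _ _ _ _ f fl.
pose G := GRing.isLinear.Build _ _ _ _ g gl.
pose f' : {linear tensor -> U} := HB.pack f F.
pose g' : {linear tensor -> U} := HB.pack g G.
rewrite -[t]tsum_id tsumE.
by rewrite [LHS](raddf_sum f') [RHS](raddf_sum g'); apply: eq_bigr => p _; exact: fg.
Qed.

End TensorQuotient.

Arguments tens {k V W} v w.
Arguments tsum {k V W U} f t.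

Notation "V ⊗ W" := (tensor V%type W%type) : type_scope.
Notation "x ⊗ y" := (tens x y) : ring_scope.
Notation "\tsum_ ( a ⊗ b <- t ) E" := (tsum (fun a b => E) t) : ring_scope.

Lemma bilin_tens (k : fieldType) (V W X U : lmodType k) (f : V -> X) (g : W -> U) :
  linear f -> linear g -> bilin (fun v w => f v ⊗ g w).
Proof.
have [tl tr] := @tens_bilin k X U.
by move=> lf lg; split=> u a x y /=; rewrite ?lf ?lg ?tl ?tr.
Qed.

Lemma tsum_lin_arg (k : fieldType) (V W X U : lmodType k)
    (f : V -> W -> U) (r : X -> V ⊗ W) :
  linear r -> bilin f -> linear (fun x => tsum f (r x)).
Proof. by move=> lr bf a x y; rewrite lr tsum_linear. Qed.

Lemma tsum_lin_summand (k : fieldType) (V W X U : lmodType k)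
    (f : X -> V -> W -> U) (t : V ⊗ W) :
  (forall v w, linear (fun x => f x v w)) -> linear (fun x => tsum (f x) t).
Proof.
move=> lf a x y; rewrite !tsumE scaler_sumr -big_split /=.
by apply: eq_bigr => p _; exact: lf.
Qed.

(* A nonzero vector is detected by a linear form; needed for 1 ⊗ 1 != 0.      *)
Section SeparatingForm.
Variables (k : fieldType) (V : lmodType k) (v0 : V).
Hypothesis v0_neq0 : v0 != 0.
Local Open Scope classical_set_scope.

Definition partial_form (G : set (V * k)) : Prop :=
  [/\ G (v0, 1),
      (forall a p q, G p -> G q -> G (a *: p.1 + q.1, a * p.2 + q.2)) &
      (forall c, G (0, c) -> c = 0)].

Lemma partial_form_line : partial_form [set p | p.1 = p.2 *: v0].
Proof.
split=> /=; first by rewrite scale1r.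
- by move=> a p q -> ->; rewrite scalerDl scalerA.
- by move=> c /eqP; rewrite eq_sym scaler_eq0 (negPf v0_neq0) orbF => /eqP.
Qed.

Lemma partial_form0 G : partial_form G -> G (0, 0).
Proof.
move=> [G1 GD _]; have := GD (-1) _ _ G1 G1.
by rewrite /= scaleN1r mulN1r !addNr.
Qed.

Lemma separating_form : exists f : V -> k^o, linear f /\ f v0 = 1.
Proof.
pose P (G : set (V * k)) := G = set0 \/ partial_form G.
have [|G [PG Gmax]] := @Zorn_bigcup _ P.
  move=> F FP Ftot.
  have [[X [FX [p Xp]]]|nF] := pselect (exists X, F X /\ exists p, X p); last first.
    left; apply/seteqP; split=> // p [X FX Xp]; apply: nF; by exists X; split=> //; exists p.
  have pfF Y q : F Y -> Y q -> partial_form Y.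
    by move=> FY Yq; case: (FP _ FY) => // Y0; rewrite Y0 in Yq.
  right; split.
  - by exists X => //; case: (pfF _ _ FX Xp).
  - move=> a q r [Y FY Yq] [Z FZ Zr].
    case: (Ftot _ _ FY FZ) => [YZ|ZY].
      by exists Z => //; case: (pfF _ _ FZ Zr) => _ + _; apply=> //; exact: YZ.
    by exists Y => //; case: (pfF _ _ FY Yq) => _ + _; apply=> //; exact: ZY.
  - by move=> c [Y FY Yc]; case: (pfF _ _ FY Yc) => _ _; apply.
have {}PG : partial_form G.
  case: PG => // G0; exfalso; apply: (Gmax [set p | p.1 = p.2 *: v0]).
    rewrite G0; split=> // /(_ (v0, 1)) /=; rewrite scale1r; exact.
  by right; exact: partial_form_line.
have [G1 GD G0] := PG.
have G00 := partial_form0 PG.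
have Gtot v : exists c, G (v, c).
  apply: contrapT => nv.
  pose G' : set (V * k) := [set p | exists a x, G (x, p.2) /\ p.1 = a *: v + x].
  apply: (Gmax G').
    split=> [[x c] Gxc|G'G]; first by exists 0, x; rewrite scale0r add0r.
    apply: nv; exists 0; apply: G'G; exists 1, 0.
    by rewrite scale1r addr0.
  right; split.
  - by exists 0, v0; rewrite scale0r add0r.
  - move=> a [p1 c] [q1 d] /= [b [x [Gx /= ->]]] [e [y [Gy /= ->]]].
    exists (a * b + e), (a *: x + y); split; first exact: (GD a _ _ Gx Gy).
    by rewrite scalerDr scalerDl scalerA addrACA.
  - move=> c [a [x [Gx /= e]]].
    have [a0|a0] := eqVneq a 0.
      by apply: G0; move: Gx; rewrite e a0 scale0r add0r.
    exfalso; apply: nv; exists (- a^-1 * c).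
    have := GD (- a^-1) _ _ Gx G00; rewrite /= !addr0.
    suff -> : - a^-1 *: x = v by [].
    have -> : x = - (a *: v) by apply/eqP; rewrite -addr_eq0 addrC -e.
    by rewrite scaleNr scalerN opprK scalerA mulVf // scale1r.
have Gfun v c d : G (v, c) -> G (v, d) -> c = d.
  move=> Gc Gd; have := GD (-1) _ _ Gc Gd.
  rewrite /= scaleN1r addNr mulN1r => /G0 /eqP.
  by rewrite addrC subr_eq0 => /eqP.
have [f Gf] := choice Gtot.
exists f; split=> [a x y|]; last exact: Gfun (Gf _) G1.
by apply: (Gfun (a *: x + y)) => //; exact: (GD a _ _ (Gf x) (Gf y)).
Qed.

End SeparatingForm.

Lemma tens_neq0 (k : fieldType) (V W : lmodType k) (v : V) (w : W) :
  v != 0 -> w != 0 -> v ⊗ w != 0.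
Proof.
move=> /separating_form [f [lf fv]] /separating_form [g [lg gw]].
have bfg : bilin (fun v w => f v * g w : k^o).
  split=> u a x y /=; first by rewrite lf mulrDl -!scalerAl.
  by rewrite lg mulrDr -!scalerAr.
apply/eqP => vw0; have := tsum_tens bfg v w.
rewrite vw0 tsum_zero // fv gw mulr1 => /eqP.
by rewrite eq_sym oner_eq0.
Qed.

Section TensorAlgebra.
Variables (k : fieldType) (A B : algType k).

Definition tmul (x y : A ⊗ B) : A ⊗ B :=
  \tsum_(a ⊗ b <- x) \tsum_(a' ⊗ b' <- y) (a * a' ⊗ b * b').

Let mull (C : algType k) (c : C) : linear ( *%R c).
Proof. by move=> a x y; rewrite mulrDr -scalerAr. Qed.
Let mulr (C : algType k) (c : C) : linear ( *%R^~ c).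
Proof. by move=> a x y; rewrite mulrDl -scalerAl. Qed.

Lemma tmul_bilin_in (a : A) (b : B) : bilin (fun a' b' => a * a' ⊗ b * b').
Proof. exact: bilin_tens (mull a) (mull b). Qed.

Lemma tmul_bilin_out (y : A ⊗ B) :
  bilin (fun a b => \tsum_(a' ⊗ b' <- y) (a * a' ⊗ b * b')).
Proof.
by split=> u; apply: tsum_lin_summand => a' b' c x z;
   case: (bilin_tens (mulr a') (mulr b')) => l r; rewrite /= ?l ?r.
Qed.

Lemma tensM (a a' : A) (b b' : B) :
  tmul (a ⊗ b) (a' ⊗ b') = (a * a') ⊗ (b * b').
Proof.
rewrite /tmul tsum_tens; last exact: tmul_bilin_out.
by rewrite tsum_tens //; exact: tmul_bilin_in.
Qed.

Lemma tmul_bilin : bilin tmul.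
Proof.
split=> [y|x] c u v; first by apply: tsum_linear; exact: tmul_bilin_out.
apply: (@tsum_lin_summand _ _ _ _ _ (fun y a b => \tsum_(a' ⊗ b' <- y) (a * a' ⊗ b * b'))).
by move=> a b; apply: tsum_linear; exact: tmul_bilin_in.
Qed.

Let tmull x : linear (tmul x). Proof. by case: tmul_bilin. Qed.
Let tmulr x : linear (tmul^~ x). Proof. by case: tmul_bilin. Qed.

Lemma tmulA : associative tmul.
Proof.
move=> x y z.
apply: (linear_ext (f := fun x => tmul x (tmul y z)) (g := fun x => tmul (tmul x y) z))
  => [c u v|c u v|a b]; rewrite ?tmulr //.
apply: (linear_ext (f := fun y => tmul _ (tmul y z)) (g := fun y => tmul (tmul _ y) z))
  => [c u v|c u v|a' b']; rewrite ?(tmulr, tmull) //.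
apply: (linear_ext (f := fun z => tmul _ (tmul _ z)) (g := fun z => tmul (tmul _ _) z))
  => [c u v|c u v|a'' b'']; rewrite ?(tmulr, tmull) //.
by rewrite !tensM !mulrA.
Qed.

Lemma tmul1 : left_id (1 ⊗ 1) tmul.
Proof.
move=> x; apply: (linear_ext (f := tmul (1 ⊗ 1)) (g := id)) => // a b.
by rewrite tensM !mul1r.
Qed.

Lemma tmulr1 : right_id (1 ⊗ 1) tmul.
Proof.
move=> x; apply: (linear_ext (f := tmul^~ (1 ⊗ 1)) (g := id)) => // a b.
by rewrite tensM !mulr1.
Qed.

Lemma tmulDl : left_distributive tmul +%R.
Proof. by move=> x y z; have := tmulr z 1 x y; rewrite !scale1r. Qed.
Lemma tmulDr : right_distributive tmul +%R.
Proof. by move=> x y z; have := tmull x 1 y z; rewrite !scale1r. Qed.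

Lemma tens11_neq0 : (1 : A) ⊗ (1 : B) != 0.
Proof. by rewrite tens_neq0 ?oner_neq0. Qed.

HB.instance Definition _ := GRing.Zmodule_isNzRing.Build (tensor A B)
  tmulA tmul1 tmulr1 tmulDl tmulDr tens11_neq0.

Lemma tscaleAl (c : k) (x y : A ⊗ B) : c *: (x * y) = (c *: x) * y.
Proof.
have /= := tmulr y c x 0; rewrite addr0 => e.
by rewrite [RHS]e [tmul 0 y](mul0r (y : A ⊗ B)) addr0.
Qed.
Lemma tscaleAr (c : k) (x y : A ⊗ B) : c *: (x * y) = x * (c *: y).
Proof.
have /= := tmull x c y 0; rewrite addr0 => e.
by rewrite [RHS]e [tmul x 0](mulr0 (x : A ⊗ B)) addr0.
Qed.

HB.instance Definition _ := GRing.Lmodule_isLalgebra.Build k (tensor A B) tscaleAl.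
HB.instance Definition _ := GRing.Lalgebra_isAlgebra.Build k (tensor A B) tscaleAr.

Lemma tens_mul (a a' : A) (b b' : B) :
  (a ⊗ b) * (a' ⊗ b') = (a * a') ⊗ (b * b').
Proof. exact: tensM. Qed.

Lemma tens_one : 1 = 1 ⊗ 1 :> A ⊗ B.
Proof. by []. Qed.

End TensorAlgebra.

Definition alg_hom (k : fieldType) (A B : algType k) (f : A -> B) : Prop :=
  linear f /\ monoid_morphism f.

Record is_bialgebra (k : fieldType) (A : algType k)
    (Delta : A -> A ⊗ A) (eps : A -> k^o) : Prop := {
  bialg_comul_hom : alg_hom Delta;
  bialg_counit_hom : alg_hom eps;
  bialg_coassoc : forall h,
    \tsum_(a ⊗ b <- Delta h) \tsum_(a1 ⊗ a2 <- Delta a) (a1 ⊗ a2 ⊗ b) =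
    \tsum_(a ⊗ b <- Delta h) \tsum_(b1 ⊗ b2 <- Delta b) (a ⊗ b1 ⊗ b2);
  bialg_counitl : forall h, \tsum_(a ⊗ b <- Delta h) (eps a *: b) = h;
  bialg_counitr : forall h, \tsum_(a ⊗ b <- Delta h) (eps b *: a) = h
}.

(* V is a left comodule over the coalgebra (C, Delta, eps) via rho *)
Record is_left_comodule (k : fieldType) (C V : lmodType k)
    (Delta : C -> C ⊗ C) (eps : C -> k^o) (rho : V -> C ⊗ V) : Prop := {
  lcomod_linear : linear rho;
  lcomod_coassoc : forall x,
    \tsum_(c ⊗ y <- rho x) \tsum_(c1 ⊗ c2 <- Delta c) (c1 ⊗ c2 ⊗ y) =
    \tsum_(c ⊗ y <- rho x) \tsum_(d ⊗ z <- rho y) (c ⊗ d ⊗ z);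
  lcomod_counit : forall x, \tsum_(c ⊗ y <- rho x) (eps c *: y) = x
}.

(* nabla x = x_<-1> ⊗ x_<0>,  btri h = h^[0] ⊗ h^[1],                         *)
(* delta x = x_{1} ⊗ x_{2},   sigma h = h^{1} ⊗ h^{2}                         *)
Record cocycle_dcc_pair (k : fieldType) (M H : algType k)
    (Delta : H -> H ⊗ H) (eps : H -> k^o) (eta : M -> k^o)
    (nabla : M -> H ⊗ M) (btri : H -> H ⊗ M)
    (delta : M -> M ⊗ M) (sigma : H -> M ⊗ M) : Prop := {
  dcc_bialgebra : is_bialgebra Delta eps;
  dcc_eta_hom : alg_hom eta;
  dcc_nabla_hom : alg_hom nabla;
  dcc_btri_hom : alg_hom btri;
  dcc_delta_hom : alg_hom delta;
  dcc_sigma_hom : alg_hom sigma;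
  dcc_nabla_counit : forall x, \tsum_(a ⊗ y <- nabla x) (eps a *: y) = x;
  dcc_btri_eta : forall h, \tsum_(a ⊗ y <- btri h) (eta y *: a) = h;
  dcc_nabla_eta : forall x, \tsum_(a ⊗ y <- nabla x) (eta y *: a) = eta x *: 1;
  dcc_btri_counit : forall h, \tsum_(a ⊗ y <- btri h) (eps a *: y) = eps h *: 1;
  dcc_sigma_eta : forall h, \tsum_(y ⊗ z <- sigma h) (eta y * eta z : k^o) = eps h
}.

Section CocycleCoproduct.
Variables (k : fieldType) (M H : algType k).
Variables (Delta : H -> H ⊗ H) (eps : H -> k^o) (eta : M -> k^o).
Variables (nabla : M -> H ⊗ M) (btri : H -> H ⊗ M).
Variables (delta : M -> M ⊗ M) (sigma : H -> M ⊗ M).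

Definition dcc_comul (t : M ⊗ H) : (M ⊗ H) ⊗ (M ⊗ H) :=
  \tsum_(x ⊗ h <- t)
  \tsum_(x1 ⊗ x2 <- delta x)
  \tsum_(x2m ⊗ x20 <- nabla x2)
  \tsum_(h1 ⊗ h23 <- Delta h) \tsum_(h2 ⊗ h3 <- Delta h23)
  \tsum_(y ⊗ z <- sigma h1)
  \tsum_(zm ⊗ z0 <- nabla z)
  \tsum_(u ⊗ v <- btri h2)
    ((x1 * y ⊗ x2m * zm * u) ⊗ (x20 * z0 * v ⊗ h3)).

Definition dcc_counit (t : M ⊗ H) : k^o :=
  \tsum_(x ⊗ h <- t) (eta x * eps h : k^o).

(* On pure tensors these are the displayed formulas, independently of the     *)
(* decompositions chosen by [tsum].                                           *)
Hypotheses (Delta_lin : linear Delta) (eps_lin : linear eps) (eta_lin : linear eta).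
Hypotheses (nabla_lin : linear nabla) (btri_lin : linear btri).
Hypotheses (delta_lin : linear delta) (sigma_lin : linear sigma).

Lemma dcc_comul_tens (x : M) (h : H) : dcc_comul (x ⊗ h) =
  \tsum_(x1 ⊗ x2 <- delta x)
  \tsum_(x2m ⊗ x20 <- nabla x2)
  \tsum_(h1 ⊗ h23 <- Delta h) \tsum_(h2 ⊗ h3 <- Delta h23)
  \tsum_(y ⊗ z <- sigma h1)
  \tsum_(zm ⊗ z0 <- nabla z)
  \tsum_(u ⊗ v <- btri h2)
    ((x1 * y ⊗ x2m * zm * u) ⊗ (x20 * z0 * v ⊗ h3)).
Proof.
apply: tsum_tens.
have [tl1 tr1] := @tens_bilin k M H.
have [tl2 tr2] := @tens_bilin k (tensor M H) (tensor M H).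
by repeat first
  [ exact: delta_lin | exact: nabla_lin | exact: Delta_lin
  | exact: sigma_lin | exact: btri_lin
  | split=> ?
  | apply: tsum_lin_arg
  | apply: tsum_lin_summand => ? ?
  | move=> ? ? ? /=; rewrite ?(mulrDl, mulrDr, tl1, tr1, tl2, tr2, =^~ scalerAl, =^~ scalerAr) ].
Qed.

Lemma dcc_counit_tens (x : M) (h : H) : dcc_counit (x ⊗ h) = eta x * eps h.
Proof.
apply: (@tsum_tens _ _ _ _ (fun x h => eta x * eps h : k^o)).
split=> u a y z /=; first by rewrite eta_lin mulrDl -scalerAl.
by rewrite eps_lin mulrDr -scalerAr.
Qed.

End CocycleCoproduct.

(* Main.v *)
(* For algebra maps f, g with commuting images and a map t into a tensor product,
   write conv t f g for x |-> f (t x)_1 * g (t x)_2. All the structure maps being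
   algebra maps, each condition is an equality of nested convolutions, and it can
   be pushed along algebra maps of the tensor factors with commuting images.
   The comultiplication restricts to M as x |-> x_{1} nabla(x_{2}) and to H as
   h |-> sigma(h_1) btri(h_2) h_3, the second leg of sigma being expanded by
   nabla. It is multiplicative as soon as these restrictions are and commute,
   which is what conditions 9 and 10 say. Then coassociativity need only be
   checked on M and on H, where it is a rewriting with conditions 3-8.
   Conversely, every condition is recovered by collapsing some of the tensor
   factors of an axiom with eta or eps. *)
From HB Require Import structures.
Require Import Defs.
From mathcomp Require Import all_boot all_order all_algebra.
From mathcomp Require Import boolp.

Set Implicit Arguments.
Unset Strict Implicit.
Unset Printing Implicit Defensive.

Import GRing.Theory.
Local Open Scope ring_scope.

(** * Sweedler sums: congruence, linearity and exchange *)

Section TensorSums.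
Variable k : fieldType.

Lemma eq_tsum (V W U : lmodType k) (f g : V -> W -> U) (t : V ⊗ W) :
  (forall a b, f a b = g a b) -> tsum f t = tsum g t.
Proof. by move=> fg; rewrite !tsumE; apply: eq_bigr => p _; exact: fg. Qed.

Lemma linear_tsum (V W U U' : lmodType k) (phi : U -> U') (f : V -> W -> U)
    (t : V ⊗ W) :
  linear phi -> phi (tsum f t) = \tsum_(a ⊗ b <- t) phi (f a b).
Proof.
move=> lphi; pose L := GRing.isLinear.Build _ _ _ _ phi lphi.
pose phi' : {linear U -> U'} := HB.pack phi L.
by rewrite !tsumE [LHS](raddf_sum phi').
Qed.

(** Each [tsum] is a finite sum over a chosen representative, so this is an exchange of two finite
    sums. *)
Lemma exchange_tsum (V W V' W' U : lmodType k) (f : V -> W -> V' -> W' -> U)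
    (s : V ⊗ W) (t : V' ⊗ W') :
  \tsum_(a ⊗ b <- s) \tsum_(c ⊗ d <- t) f a b c d =
  \tsum_(c ⊗ d <- t) \tsum_(a ⊗ b <- s) f a b c d.
Proof. by rewrite !tsumE exchange_big. Qed.

Lemma tsum_mull (V W : lmodType k) (R : algType k) (f : V -> W -> R) (t : V ⊗ W)
    (c : R) :
  tsum f t * c = \tsum_(a ⊗ b <- t) (f a b * c).
Proof. by rewrite !tsumE mulr_suml. Qed.

Lemma tsum_mulr (V W : lmodType k) (R : algType k) (f : V -> W -> R) (t : V ⊗ W)
    (c : R) :
  c * tsum f t = \tsum_(a ⊗ b <- t) (c * f a b).
Proof. by rewrite !tsumE mulr_sumr. Qed.

End TensorSums.

(** * Convolution of maps into an algebra *)

Section Convolution.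
Variable k : fieldType.
Implicit Types A B C D E F R S X : algType k.

(* In Sweedler notation, x |-> f (t x)_1 * g (t x)_2; the multiplication of R is
   the only product involved. *)
Definition conv (X : Type) A B R (t : X -> A ⊗ B) (f : A -> R) (g : B -> R)
    (x : X) : R :=
  \tsum_(a ⊗ b <- t x) (f a * g b).

Definition comm_maps (X Y : Type) R (f : X -> R) (g : Y -> R) : Prop :=
  forall a b, f a * g b = g b * f a.

Definition tinl A B (a : A) : A ⊗ B := a ⊗ 1.
Definition tinr A B (b : B) : A ⊗ B := 1 ⊗ b.

Lemma linear_scalar A R (f : A -> R) c x : linear f -> f (c *: x) = c *: f x.
Proof.
move=> lf; have f0 : f 0 = 0.
  by have := lf (-1) 0 0; rewrite scaleN1r oppr0 addr0 scaleN1r addNr.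
by rewrite -[c *: x]addr0 lf f0 addr0.
Qed.

Lemma alg_hom_linear A R (f : A -> R) : alg_hom f -> linear f.
Proof. by case. Qed.

Lemma alg_hom1 A R (f : A -> R) : alg_hom f -> f 1 = 1.
Proof. by case=> _ []. Qed.

Lemma alg_homM A R (f : A -> R) x y : alg_hom f -> f (x * y) = f x * f y.
Proof. by case=> _ [_]; apply. Qed.

Lemma alg_hom_id A : alg_hom (@id A).
Proof. by []. Qed.

Lemma alg_hom_comp A R S (f : R -> S) (g : A -> R) :
  alg_hom f -> alg_hom g -> alg_hom (f \o g).
Proof.
move=> hf hg; split=> [c x y|] /=; first by rewrite !alg_hom_linear.
by split=> [|x y] /=;
  rewrite ?(alg_hom1 hg, alg_hom1 hf, alg_homM _ _ hg, alg_homM _ _ hf).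
Qed.

Lemma alg_hom_tinl A B : alg_hom (@tinl A B).
Proof.
split=> [c x y|]; first by case: (@tens_bilin k A B) => + _; apply.
by split=> // x y; rewrite /tinl tens_mul mulr1.
Qed.

Lemma alg_hom_tinr A B : alg_hom (@tinr A B).
Proof.
split=> [c x y|]; first by case: (@tens_bilin k A B) => _; apply.
by split=> // x y; rewrite /tinr tens_mul mulr1.
Qed.

Lemma tinl_mul_tinr A B (a : A) (b : B) : tinl B a * tinr A b = a ⊗ b.
Proof. by rewrite /tinl /tinr tens_mul mulr1 mul1r. Qed.

Lemma bilin_mul A B R (f : A -> R) (g : B -> R) :
  linear f -> linear g -> bilin (fun a b => f a * g b).
Proof.
move=> lf lg; split=> u c x y /=; first by rewrite lf mulrDl -scalerAl.
by rewrite lg mulrDr -scalerAr.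
Qed.

Lemma linear_conv X A B R (t : X -> A ⊗ B) (f : A -> R) (g : B -> R) :
  linear t -> linear f -> linear g -> linear (conv t f g).
Proof.
by move=> lt lf lg c x y; rewrite /conv lt tsum_linear //; exact: bilin_mul.
Qed.

(** Splits a convolution into [t] and the map on [A ⊗ B] induced by [f] and [g]; statements about
    the latter can be checked on pure tensors. *)
Lemma conv_idE (X : Type) A B R (t : X -> A ⊗ B) (f : A -> R) (g : B -> R) :
  conv t f g = conv id f g \o t.
Proof. by []. Qed.

Lemma conv_tens A B R (f : A -> R) (g : B -> R) a b :
  linear f -> linear g -> conv id f g (a ⊗ b) = f a * g b.
Proof.
by move=> lf lg; rewrite /conv tsum_tens //; exact: bilin_mul.
Qed.

Lemma conv_tinl A B R (f : A -> R) (g : B -> R) :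
  linear f -> linear g -> g 1 = 1 -> conv id f g \o @tinl A B = f.
Proof. by move=> lf lg g1; apply/funext => a /=; rewrite conv_tens // g1 mulr1. Qed.

Lemma conv_tinr A B R (f : A -> R) (g : B -> R) :
  linear f -> linear g -> f 1 = 1 -> conv id f g \o @tinr A B = g.
Proof. by move=> lf lg f1; apply/funext => a /=; rewrite conv_tens // f1 mul1r. Qed.

Lemma conv_tinl_tinr A B : conv id (@tinl A B) (@tinr A B) = id.
Proof.
by apply/funext => t; rewrite -[RHS]tsum_id; apply: eq_tsum => a b; exact: tinl_mul_tinr.
Qed.

(** Universal property of the tensor product of algebras. Both sides of multiplicativity are linear
    in each variable, so pure tensors suffice; there [fg] moves [f a'] past [g b]. *)
Lemma alg_hom_conv_id A B R (f : A -> R) (g : B -> R) :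
  alg_hom f -> alg_hom g -> comm_maps f g -> alg_hom (conv id f g).
Proof.
move=> hf hg fg; have lf := alg_hom_linear hf; have lg := alg_hom_linear hg.
have lc : linear (conv id f g) by exact: linear_conv.
split=> //; split=> [|x y].
  by rewrite tens_one conv_tens // (alg_hom1 hf) (alg_hom1 hg) mulr1.
have [ml mr] := @tmul_bilin k A B.
apply: (linear_ext (f := fun x => conv id f g (x * y))
  (g := fun x => conv id f g x * conv id f g y)) => [c u v|c u v|a b].
- by rewrite [(_ + _) * y]ml lc.
- by rewrite lc mulrDl scalerAl.
apply: (linear_ext (f := fun y => conv id f g (_ * y))
  (g := fun y => conv id f g _ * conv id f g y)) => [c u v|c u v|a' b'].
- by rewrite [_ * (_ + _)]mr lc.
- by rewrite lc mulrDr scalerAr.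
rewrite tens_mul !conv_tens // (alg_homM _ _ hf) (alg_homM _ _ hg).
by rewrite !mulrA -[_ * f a' * _]mulrA fg !mulrA.
Qed.

Lemma alg_hom_conv X A B R (t : X -> A ⊗ B) (f : A -> R) (g : B -> R) :
  alg_hom t -> alg_hom f -> alg_hom g -> comm_maps f g -> alg_hom (conv t f g).
Proof.
by move=> ht hf hg fg; rewrite conv_idE; apply: alg_hom_comp => //;
  exact: alg_hom_conv_id.
Qed.

Lemma conv1 A B X R (t : X -> A ⊗ B) (f : A -> R) (g : B -> R) :
  linear f -> linear g -> t 1 = 1 -> f 1 = 1 -> g 1 = 1 -> conv t f g 1 = 1.
Proof.
by move=> lf lg t1 f1 g1; rewrite conv_idE /= t1 tens_one conv_tens // f1 g1 mulr1.
Qed.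

Lemma alg_hom_conv_tinl A B R (f : A -> R) (g : B -> R) :
  alg_hom f -> alg_hom g -> conv id f g \o @tinl A B = f.
Proof.
by move=> hf hg; apply: conv_tinl; [exact: alg_hom_linear.. | exact: alg_hom1].
Qed.

Lemma alg_hom_conv_tinr A B R (f : A -> R) (g : B -> R) :
  alg_hom f -> alg_hom g -> conv id f g \o @tinr A B = g.
Proof.
by move=> hf hg; apply: conv_tinr; [exact: alg_hom_linear.. | exact: alg_hom1].
Qed.

Lemma conv_tensE (X : Type) A B (t : X -> A ⊗ B) : conv t (@tinl A B) (@tinr A B) = t.
Proof. by rewrite conv_idE conv_tinl_tinr. Qed.

(** Algebra maps preserve the finite sums and products from which a convolution is built. This is
    how identities are pushed from one algebra to another. *)
Lemma comp_conv (X : Type) A B R S (phi : R -> S) (t : X -> A ⊗ B)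
    (f : A -> R) (g : B -> R) :
  alg_hom phi -> phi \o conv t f g = conv t (phi \o f) (phi \o g).
Proof.
move=> hphi; apply/funext => x; rewrite /= /conv linear_tsum; last exact: alg_hom_linear.
by apply: eq_tsum => a b; rewrite alg_homM.
Qed.

Lemma comm_maps_sym (X Y : Type) R (f : X -> R) (g : Y -> R) :
  comm_maps f g -> comm_maps g f.
Proof. by move=> fg a b. Qed.

Lemma comm_maps_conv (X Y : Type) A B R (t : X -> A ⊗ B) (f : A -> R)
    (g : B -> R) (h : Y -> R) :
  comm_maps f h -> comm_maps g h -> comm_maps (conv t f g) h.
Proof.
move=> fh gh x y; rewrite /conv tsum_mull tsum_mulr; apply: eq_tsum => a b.
by rewrite -mulrA gh mulrA fh mulrA.
Qed.

Lemma comm_maps_comp (X Y : Type) R S (phi : R -> S) (f : X -> R) (g : Y -> R) :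
  alg_hom phi -> comm_maps f g -> comm_maps (phi \o f) (phi \o g).
Proof. by move=> hphi fg a b; rewrite /= -!(alg_homM _ _ hphi) fg. Qed.

Lemma comm_tinl_tinr A B : comm_maps (@tinl A B) (@tinr A B).
Proof. by move=> a b; rewrite /tinl /tinr !tens_mul !(mulr1, mul1r). Qed.

Lemma comm_maps_tinl_tinr (X Y : Type) A B (f : X -> A) (g : Y -> B) :
  comm_maps (@tinl A B \o f) (@tinr A B \o g).
Proof. by move=> a b; exact: comm_tinl_tinr. Qed.

(** Four unrelated structure maps are allowed, so that coassociativity of a coalgebra and of a
    comodule are both instances. *)
Lemma conv_coassoc (X : Type) C D E F (Y : algType k) R
    (s : X -> C ⊗ D) (s' : C -> E ⊗ Y) (u : X -> E ⊗ F) (u' : F -> Y ⊗ D)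
    (f1 : E -> R) (f2 : Y -> R) (f3 : D -> R) :
  (forall x, \tsum_(a ⊗ b <- s x) \tsum_(c ⊗ d <- s' a) (c ⊗ d ⊗ b) =
             \tsum_(a ⊗ b <- u x) \tsum_(c ⊗ d <- u' b) (a ⊗ c ⊗ d)) ->
  linear f1 -> linear f2 -> linear f3 ->
  conv s (conv s' f1 f2) f3 = conv u f1 (conv u' f2 f3).
Proof.
move=> su l1 l2 l3; apply/funext => x.
have l12 : linear (conv id f1 f2) by exact: linear_conv.
have l : linear (conv id (conv id f1 f2) f3) by exact: linear_conv.
(* Both nested convolutions are images of the two sides of the hypothesis under the linear map
   sending [a ⊗ b ⊗ c] to [f1 a * f2 b * f3 c]. *)
transitivity (conv id (conv id f1 f2) f3
    (\tsum_(a ⊗ b <- s x) \tsum_(c ⊗ d <- s' a) (c ⊗ d ⊗ b))).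
  rewrite [RHS]linear_tsum //; apply: eq_tsum => a b.
  rewrite [RHS]linear_tsum // [conv s' _ _ _]/conv tsum_mull.
  by apply: eq_tsum => c d; rewrite !conv_tens.
rewrite su [LHS]linear_tsum //; apply: eq_tsum => a b.
rewrite [LHS]linear_tsum // [conv u' _ _ _]/conv tsum_mulr.
by apply: eq_tsum => c d; rewrite !conv_tens // mulrA.
Qed.

End Convolution.

Arguments tinl {k A B}.
Arguments tinr {k A B}.

(** * Expanding nested convolutions into iterated Sweedler sums *)

Lemma lift_tsum_mull (k : fieldType) (V W : lmodType k) (R : algType k) (p q : R)
    (f : V -> W -> R) (t : V ⊗ W) :
  p = tsum f t -> p * q = \tsum_(a ⊗ b <- t) (f a b * q).
Proof. by move=> ->; exact: tsum_mull. Qed.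

Lemma lift_tsum_mulr (k : fieldType) (V W : lmodType k) (R : algType k) (p q : R)
    (f : V -> W -> R) (t : V ⊗ W) :
  q = tsum f t -> p * q = \tsum_(a ⊗ b <- t) (p * f a b).
Proof. by move=> ->; exact: tsum_mulr. Qed.

(* The leftmost sum comes out first: this is the order in which the conditions
   of the theorem nest their sums. *)
Ltac lift_tsum :=
  match goal with
  | |- tsum _ _ = _ => reflexivity
  | |- ?p * _ = _ =>
    match p with
    | context [tsum] => apply: lift_tsum_mull; lift_tsum
    | _ => apply: lift_tsum_mulr; lift_tsum
    end
  end.

(** Each round pulls one sum to the front, through a middle term left open for [lift_tsum] to
    determine, and strips it against the outermost sum on the right. What remains is a product of
    pure tensors. *)
Ltac expand_conv :=
  rewrite /conv /comp;
  repeat (etransitivity; [lift_tsum | apply: eq_tsum => ? ?]);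
  rewrite /tinl /tinr !tens_mul ?(mul1r, mulr1).

(** * The three factors of a triple tensor product *)

Definition in1 (k : fieldType) (A B C : algType k) : A -> A ⊗ B ⊗ C := tinl \o tinl.
Definition in2 (k : fieldType) (A B C : algType k) : B -> A ⊗ B ⊗ C := tinl \o tinr.
Definition in3 (k : fieldType) (A B C : algType k) : C -> A ⊗ B ⊗ C := tinr.

Arguments in1 {k A B C}.
Arguments in2 {k A B C}.
Arguments in3 {k A B C}.

Section Slots.
Variables (k : fieldType) (A B C : algType k).

Lemma alg_hom_in1 : alg_hom (@in1 k A B C).
Proof. by apply: alg_hom_comp; exact: alg_hom_tinl. Qed.
Lemma alg_hom_in2 : alg_hom (@in2 k A B C).
Proof. by apply: alg_hom_comp; [exact: alg_hom_tinl | exact: alg_hom_tinr]. Qed.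
Lemma alg_hom_in3 : alg_hom (@in3 k A B C).
Proof. exact: alg_hom_tinr. Qed.
Lemma comm_in12 : comm_maps (@in1 k A B C) (@in2 k A B C).
Proof. by apply: comm_maps_comp; [exact: alg_hom_tinl | exact: comm_tinl_tinr]. Qed.
Lemma comm_in13 : comm_maps (@in1 k A B C) (@in3 k A B C).
Proof. by move=> a b; exact: comm_tinl_tinr. Qed.
Lemma comm_in23 : comm_maps (@in2 k A B C) (@in3 k A B C).
Proof. by move=> a b; exact: comm_tinl_tinr. Qed.

End Slots.

(** * Characters as maps into an arbitrary algebra *)

Section ScalarMap.
Variables (k : fieldType) (A R : algType k).

Definition scalar_hom (c : k^o) : R := (c : k) *: 1.
(** Lets a character such as [eta] or [eps] take the place of a map into [R] inside [conv]; its
    values are central, so the tensor factor it is applied to disappears. *)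
Definition scalar_map (chi : A -> k^o) : A -> R := scalar_hom \o chi.

Lemma alg_hom_scalar : alg_hom scalar_hom.
Proof.
rewrite /scalar_hom; split=> [c x y|]; first by rewrite scalerDl -scalerA.
by split=> [|x y]; rewrite ?scale1r // -scalerAl mul1r scalerA.
Qed.

Lemma alg_hom_scalar_map (chi : A -> k^o) : alg_hom chi -> alg_hom (scalar_map chi).
Proof. by move=> ?; apply: alg_hom_comp => //; exact: alg_hom_scalar. Qed.

Lemma comm_scalar_map (X : Type) (chi : A -> k^o) (f : X -> R) :
  comm_maps (scalar_map chi) f.
Proof.
move=> a x; rewrite /scalar_map /scalar_hom /= mulr_algl.
by symmetry; exact: (@mulr_algr k R).
Qed.

Lemma conv_scalarl (X : Type) (B : algType k) (t : X -> A ⊗ B) (chi : A -> k^o)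
    (f : B -> R) (x : X) :
  linear f -> conv t (scalar_map chi) f x = f (\tsum_(a ⊗ b <- t x) (chi a *: b)).
Proof.
move=> lf; rewrite linear_tsum //; apply: eq_tsum => a b.
by rewrite (linear_scalar _ _ lf); exact: (@mulr_algl k R).
Qed.

Lemma conv_scalarr (X : Type) (B : algType k) (t : X -> B ⊗ A) (chi : A -> k^o)
    (f : B -> R) (x : X) :
  linear f -> conv t f (scalar_map chi) x = f (\tsum_(b ⊗ a <- t x) (chi a *: b)).
Proof.
move=> lf; rewrite linear_tsum //; apply: eq_tsum => a b.
by rewrite (linear_scalar _ _ lf); exact: (@mulr_algr k R).
Qed.

End ScalarMap.

(* Purely syntactic, so that failing branches never unfold [conv]. *)
Ltac solve_hom :=
  lazymatch goal with
  | |- linear ?f =>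
    match goal with
    | lf : linear f |- _ => exact: lf
    | |- linear (conv _ _ _) => apply: linear_conv; solve_hom
    | |- _ => apply: alg_hom_linear; solve_hom
    end
  | |- alg_hom ?f =>
    match goal with
    | hf : alg_hom f |- _ => exact: hf
    | |- alg_hom (conv _ _ _) => apply: alg_hom_conv; solve_hom
    | |- alg_hom tinl => exact: alg_hom_tinl
    | |- alg_hom tinr => exact: alg_hom_tinr
    | |- alg_hom (scalar_map _ _) => apply: alg_hom_scalar_map; solve_hom
    | |- alg_hom in1 => exact: alg_hom_in1
    | |- alg_hom in2 => exact: alg_hom_in2
    | |- alg_hom in3 => exact: alg_hom_in3
    | |- alg_hom id => exact: alg_hom_id
    | |- alg_hom (_ \o _) => apply: alg_hom_comp; solve_hom
    end
  | |- comm_maps ?f ?g =>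
    match goal with
    | fg : comm_maps f g |- _ => exact: fg
    | gf : comm_maps g f |- _ => exact: comm_maps_sym gf
    | |- comm_maps (conv _ _ _) _ => apply: comm_maps_conv; solve_hom
    | |- comm_maps _ (conv _ _ _) =>
      apply: comm_maps_sym; apply: comm_maps_conv; solve_hom
    | |- comm_maps (scalar_map _ _) _ => exact: comm_scalar_map
    | |- comm_maps _ (scalar_map _ _) =>
      apply: comm_maps_sym; exact: comm_scalar_map
    | |- comm_maps tinl tinr => exact: comm_tinl_tinr
    | |- comm_maps tinr tinl => exact: comm_maps_sym (@comm_tinl_tinr _ _ _)
    | |- comm_maps in1 in2 => exact: comm_in12
    | |- comm_maps in2 in1 => exact: comm_maps_sym (@comm_in12 _ _ _ _)
    | |- comm_maps in1 in3 => exact: comm_in13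
    | |- comm_maps in3 in1 => exact: comm_maps_sym (@comm_in13 _ _ _ _)
    | |- comm_maps in2 in3 => exact: comm_in23
    | |- comm_maps in3 in2 => exact: comm_maps_sym (@comm_in23 _ _ _ _)
    | |- comm_maps (tinl \o _) (tinr \o _) => exact: comm_maps_tinl_tinr
    | |- comm_maps (tinr \o _) (tinl \o _) =>
      apply: comm_maps_sym; exact: comm_maps_tinl_tinr
    | |- comm_maps (_ \o _) (_ \o _) => apply: comm_maps_comp; solve_hom
    end
  end.

(** Universal property of the triple tensor product: the embeddings [in1], [in2], [in3] are the
    generic triple of algebra maps with commuting images. *)
Lemma triple_map (k : fieldType) (A B C R : algType k) (f1 : A -> R) (f2 : B -> R)
    (f3 : C -> R) :
  alg_hom f1 -> alg_hom f2 -> alg_hom f3 ->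
  comm_maps f1 f2 -> comm_maps f1 f3 -> comm_maps f2 f3 ->
  exists phi : A ⊗ B ⊗ C -> R, [/\ alg_hom phi,
    phi \o @in1 k A B C = f1, phi \o @in2 k A B C = f2 & phi \o @in3 k A B C = f3].
Proof.
move=> hf1 hf2 hf3 c12 c13 c23.
exists (conv id (conv id f1 f2) f3); split; first by solve_hom.
- rewrite /in1 compA conv_tinl ?(alg_hom1 hf3) ?conv_tinl ?(alg_hom1 hf2) //; solve_hom.
- rewrite /in2 compA conv_tinl ?(alg_hom1 hf3) ?conv_tinr ?(alg_hom1 hf1) //; solve_hom.
- have h : alg_hom (conv id f1 f2) by solve_hom.
  rewrite /in3 conv_tinr ?(alg_hom1 h) //; solve_hom.
Qed.

Lemma pointwise_eqP (X Y : Type) (f g F G : X -> Y) :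
  (forall x, f x = F x) -> (forall x, g x = G x) ->
  (forall x, F x = G x) <-> f = g.
Proof.
move=> fF gG; split=> [FG|fg x]; first by apply/funext => x; rewrite fF gG.
by rewrite -fF -gG fg.
Qed.

Lemma coassocP (k : fieldType) (A : algType k) (D : A -> A ⊗ A) :
  (forall x, \tsum_(a ⊗ b <- D x) \tsum_(a1 ⊗ a2 <- D a) (a1 ⊗ a2 ⊗ b) =
             \tsum_(a ⊗ b <- D x) \tsum_(b1 ⊗ b2 <- D b) (a ⊗ b1 ⊗ b2)) <->
  conv D (conv D (@in1 k A A A) in2) in3 = conv D (@in1 k A A A) (conv D in2 in3).
Proof. by apply: pointwise_eqP => x; rewrite /in1 /in2 /in3; expand_conv. Qed.

(** * Conditions 3-8 as equalities of convolutions *)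

Section Conditions.
Variables (k : fieldType) (M H : algType k).
Variables (Delta : H -> H ⊗ H) (nabla : M -> H ⊗ M) (btri : H -> H ⊗ M).
Variables (delta : M -> M ⊗ M) (sigma : H -> M ⊗ M).

Section ConditionForms.
Variables (R : algType k).

(* Conditions 3-8 of the theorem read inside an arbitrary algebra R into which
   the three tensor factors are mapped by f1, f2, f3. *)
Definition form3 (f1 f2 : H -> R) (f3 : M -> R) :=
  conv nabla (conv Delta f1 f2) f3 = conv nabla f1 (conv nabla f2 f3).

Definition form4 (f1 : M -> R) (f2 : M -> R) (f3 : M -> R) :=
  conv delta f1 (conv delta f2 f3) =
  conv delta (conv delta f1 f2) (conv nabla (conv sigma f1 f2) f3).

Definition form5 (f1 : H -> R) (f2 f3 : M -> R) :=
  conv nabla f1 (conv delta f2 f3) =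
  conv delta (conv nabla f1 f2) (conv nabla (conv btri f1 f2) f3).

Definition form6 (f1 f2 f3 : M -> R) :=
  conv Delta (conv sigma f1 (conv delta f2 f3)) (conv sigma f2 f3) =
  conv Delta (conv sigma (conv delta f1 f2) (conv nabla (conv sigma f1 f2) f3))
    (conv btri (conv sigma f1 f2) f3).

Definition form7 (f1 : H -> R) (f2 f3 : M -> R) :=
  conv Delta (conv btri f1 (conv delta f2 f3)) (conv sigma f2 f3) =
  conv Delta (conv sigma (conv nabla f1 f2) (conv nabla (conv btri f1 f2) f3))
    (conv btri (conv btri f1 f2) f3).

Definition form8 (f1 f2 : H -> R) (f3 : M -> R) :=
  conv Delta (conv btri f1 (conv nabla f2 f3)) (conv btri f2 f3) =
  conv btri (conv Delta f1 f2) f3.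

End ConditionForms.

Lemma form3P : (forall x : M,
    \tsum_(c ⊗ y <- nabla x) \tsum_(c1 ⊗ c2 <- Delta c) (c1 ⊗ c2 ⊗ y) =
    \tsum_(c ⊗ y <- nabla x) \tsum_(d ⊗ z <- nabla y) (c ⊗ d ⊗ z)) <->
  form3 (@in1 k H H M) (@in2 k H H M) (@in3 k H H M).
Proof. by apply: pointwise_eqP => x; rewrite /in1 /in2 /in3; expand_conv. Qed.

Lemma form4P :
  (forall x : M,
     \tsum_(x1 ⊗ x2 <- delta x) \tsum_(x21 ⊗ x22 <- delta x2)
       (x1 ⊗ x21 ⊗ x22) =
     \tsum_(x1 ⊗ x2 <- delta x) \tsum_(x11 ⊗ x12 <- delta x1)
     \tsum_(x2m ⊗ x20 <- nabla x2) \tsum_(y ⊗ z <- sigma x2m)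
       (x11 * y ⊗ x12 * z ⊗ x20)) <->
  form4 (@in1 k M M M) (@in2 k M M M) (@in3 k M M M).
Proof. by apply: pointwise_eqP => x; rewrite /in1 /in2 /in3; expand_conv. Qed.

Lemma form5P :
  (forall x : M,
     \tsum_(xm ⊗ x0 <- nabla x) \tsum_(x01 ⊗ x02 <- delta x0)
       (xm ⊗ x01 ⊗ x02) =
     \tsum_(x1 ⊗ x2 <- delta x) \tsum_(x1m ⊗ x10 <- nabla x1)
     \tsum_(x2m ⊗ x20 <- nabla x2) \tsum_(u ⊗ v <- btri x2m)
       (x1m * u ⊗ x10 * v ⊗ x20)) <->
  form5 (@in1 k H M M) (@in2 k H M M) (@in3 k H M M).
Proof. by apply: pointwise_eqP => x; rewrite /in1 /in2 /in3; expand_conv. Qed.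

Lemma form6P :
  (forall h : H,
     \tsum_(h1 ⊗ h2 <- Delta h)
     \tsum_(y ⊗ z <- sigma h1) \tsum_(z1 ⊗ z2 <- delta z)
     \tsum_(y' ⊗ z' <- sigma h2)
       (y ⊗ z1 * y' ⊗ z2 * z') =
     \tsum_(h1 ⊗ h2 <- Delta h)
     \tsum_(y ⊗ z <- sigma h1) \tsum_(y1 ⊗ y2 <- delta y)
     \tsum_(zm ⊗ z0 <- nabla z) \tsum_(p ⊗ q <- sigma zm)
     \tsum_(u ⊗ v <- btri h2) \tsum_(r ⊗ s <- sigma u)
       (y1 * p * r ⊗ y2 * q * s ⊗ z0 * v)) <->
  form6 (@in1 k M M M) (@in2 k M M M) (@in3 k M M M).
Proof. by apply: pointwise_eqP => x; rewrite /in1 /in2 /in3; expand_conv. Qed.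

Lemma form7P :
  (forall h : H,
     \tsum_(h1 ⊗ h2 <- Delta h)
     \tsum_(u ⊗ v <- btri h1) \tsum_(v1 ⊗ v2 <- delta v)
     \tsum_(y ⊗ z <- sigma h2)
       (u ⊗ v1 * y ⊗ v2 * z) =
     \tsum_(h1 ⊗ h2 <- Delta h)
     \tsum_(y ⊗ z <- sigma h1) \tsum_(ym ⊗ y0 <- nabla y)
     \tsum_(zm ⊗ z0 <- nabla z) \tsum_(p ⊗ q <- btri zm)
     \tsum_(u ⊗ v <- btri h2) \tsum_(r ⊗ s <- btri u)
       (ym * p * r ⊗ y0 * q * s ⊗ z0 * v)) <->
  form7 (@in1 k H M M) (@in2 k H M M) (@in3 k H M M).
Proof. by apply: pointwise_eqP => x; rewrite /in1 /in2 /in3; expand_conv. Qed.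

Lemma form8P :
  (forall h : H,
     \tsum_(h1 ⊗ h2 <- Delta h)
     \tsum_(u ⊗ v <- btri h1) \tsum_(vm ⊗ v0 <- nabla v)
     \tsum_(u' ⊗ v' <- btri h2)
       (u ⊗ vm * u' ⊗ v0 * v') =
     \tsum_(u ⊗ v <- btri h) \tsum_(u1 ⊗ u2 <- Delta u)
       (u1 ⊗ u2 ⊗ v)) <->
  form8 (@in1 k H H M) (@in2 k H H M) (@in3 k H H M).
Proof. by apply: pointwise_eqP => x; rewrite /in1 /in2 /in3; expand_conv. Qed.

Section Transport.
Variables (R : algType k).

(** The condition is the instance at the generic triple [in1], [in2], [in3]. By [triple_map] any
    other triple is its composite with an algebra map [phi], and [comp_conv] carries [phi] through
    every convolution. The other transport lemmas follow the same way. *)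
Lemma transport3 (f1 : H -> R) (f2 : H -> R) (f3 : M -> R) :
  form3 (@in1 k H H M) (@in2 k H H M) (@in3 k H H M) ->
  alg_hom f1 -> alg_hom f2 -> alg_hom f3 ->
  comm_maps f1 f2 -> comm_maps f1 f3 -> comm_maps f2 f3 -> form3 f1 f2 f3.
Proof.
move=> E hf1 hf2 hf3 c12 c13 c23.
have [phi [hphi <- <- <-]] := triple_map hf1 hf2 hf3 c12 c13 c23.
by move/(congr1 (fun F => phi \o F)): E; rewrite !comp_conv.
Qed.

Lemma transport4 (f1 : M -> R) (f2 : M -> R) (f3 : M -> R) :
  form4 (@in1 k M M M) (@in2 k M M M) (@in3 k M M M) ->
  alg_hom f1 -> alg_hom f2 -> alg_hom f3 ->
  comm_maps f1 f2 -> comm_maps f1 f3 -> comm_maps f2 f3 -> form4 f1 f2 f3.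
Proof.
move=> E hf1 hf2 hf3 c12 c13 c23.
have [phi [hphi <- <- <-]] := triple_map hf1 hf2 hf3 c12 c13 c23.
by move/(congr1 (fun F => phi \o F)): E; rewrite !comp_conv.
Qed.

Lemma transport5 (f1 : H -> R) (f2 : M -> R) (f3 : M -> R) :
  form5 (@in1 k H M M) (@in2 k H M M) (@in3 k H M M) ->
  alg_hom f1 -> alg_hom f2 -> alg_hom f3 ->
  comm_maps f1 f2 -> comm_maps f1 f3 -> comm_maps f2 f3 -> form5 f1 f2 f3.
Proof.
move=> E hf1 hf2 hf3 c12 c13 c23.
have [phi [hphi <- <- <-]] := triple_map hf1 hf2 hf3 c12 c13 c23.
by move/(congr1 (fun F => phi \o F)): E; rewrite !comp_conv.
Qed.

Lemma transport6 (f1 : M -> R) (f2 : M -> R) (f3 : M -> R) :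
  form6 (@in1 k M M M) (@in2 k M M M) (@in3 k M M M) ->
  alg_hom f1 -> alg_hom f2 -> alg_hom f3 ->
  comm_maps f1 f2 -> comm_maps f1 f3 -> comm_maps f2 f3 -> form6 f1 f2 f3.
Proof.
move=> E hf1 hf2 hf3 c12 c13 c23.
have [phi [hphi <- <- <-]] := triple_map hf1 hf2 hf3 c12 c13 c23.
by move/(congr1 (fun F => phi \o F)): E; rewrite !comp_conv.
Qed.

Lemma transport7 (f1 : H -> R) (f2 : M -> R) (f3 : M -> R) :
  form7 (@in1 k H M M) (@in2 k H M M) (@in3 k H M M) ->
  alg_hom f1 -> alg_hom f2 -> alg_hom f3 ->
  comm_maps f1 f2 -> comm_maps f1 f3 -> comm_maps f2 f3 -> form7 f1 f2 f3.
Proof.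
move=> E hf1 hf2 hf3 c12 c13 c23.
have [phi [hphi <- <- <-]] := triple_map hf1 hf2 hf3 c12 c13 c23.
by move/(congr1 (fun F => phi \o F)): E; rewrite !comp_conv.
Qed.

Lemma transport8 (f1 : H -> R) (f2 : H -> R) (f3 : M -> R) :
  form8 (@in1 k H H M) (@in2 k H H M) (@in3 k H H M) ->
  alg_hom f1 -> alg_hom f2 -> alg_hom f3 ->
  comm_maps f1 f2 -> comm_maps f1 f3 -> comm_maps f2 f3 -> form8 f1 f2 f3.
Proof.
move=> E hf1 hf2 hf3 c12 c13 c23.
have [phi [hphi <- <- <-]] := triple_map hf1 hf2 hf3 c12 c13 c23.
by move/(congr1 (fun F => phi \o F)): E; rewrite !comp_conv.
Qed.

End Transport.
End Conditions.

(** * The comultiplication and its restrictions to the two factors *)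

Section Pair.
Variables (k : fieldType) (M H : algType k).
Variables (Delta : H -> H ⊗ H) (eps : H -> k^o) (eta : M -> k^o).
Variables (nabla : M -> H ⊗ M) (btri : H -> H ⊗ M).
Variables (delta : M -> M ⊗ M) (sigma : H -> M ⊗ M).
Hypothesis MH_pair : cocycle_dcc_pair Delta eps eta nabla btri delta sigma.

Let hDelta : alg_hom Delta. Proof. by case: MH_pair => -[]. Qed.
Let heps : alg_hom eps. Proof. by case: MH_pair => -[]. Qed.
Let heta : alg_hom eta. Proof. by case: MH_pair. Qed.
Let hnabla : alg_hom nabla. Proof. by case: MH_pair. Qed.
Let hbtri : alg_hom btri. Proof. by case: MH_pair. Qed.
Let hdelta : alg_hom delta. Proof. by case: MH_pair. Qed.
Let hsigma : alg_hom sigma. Proof. by case: MH_pair. Qed.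

Notation T := (tensor M H).

(* The comultiplication of M ⊗ H is the product of its restrictions to M and to
   H; m1, h1, m2, h2 say where the four factors of its values are mapped. *)
Definition comulM (R : algType k) (m1 : M -> R) (h1 : H -> R) (m2 : M -> R) : M -> R :=
  conv delta m1 (conv nabla h1 m2).
Definition comulH (R : algType k) (m1 : M -> R) (h1 : H -> R)
    (m2 : M -> R) (h2 : H -> R) : H -> R :=
  conv Delta (conv sigma m1 (conv nabla h1 m2)) (conv Delta (conv btri h1 m2) h2).

Lemma comp_comulM (R S : algType k) (phi : R -> S) (m1 : M -> R)
    (h1 : H -> R) (m2 : M -> R) :
  alg_hom phi -> phi \o comulM m1 h1 m2 = comulM (phi \o m1) (phi \o h1) (phi \o m2).
Proof. by move=> hphi; rewrite /comulM !comp_conv. Qed.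

Lemma comp_comulH (R S : algType k) (phi : R -> S) (m1 : M -> R) (h1 : H -> R)
    (m2 : M -> R) (h2 : H -> R) :
  alg_hom phi ->
  phi \o comulH m1 h1 m2 h2 = comulH (phi \o m1) (phi \o h1) (phi \o m2) (phi \o h2).
Proof. by move=> hphi; rewrite /comulH !comp_conv. Qed.

Notation comul := (dcc_comul Delta nabla btri delta sigma).

Lemma dcc_comulE : comul =
  conv id (comulM (@tinl k T T \o tinl) (tinl \o tinr) (tinr \o tinl))
    (comulH (@tinl k T T \o tinl) (tinl \o tinr) (tinr \o tinl) (tinr \o tinr)).
Proof.
apply/funext => t; symmetry; apply: eq_tsum => x h.
rewrite /comulM /comulH /conv /comp.
do 3 (etransitivity; [lift_tsum | apply: eq_tsum => ? ?]).
(* The displayed formula splits [h23] before expanding [sigma h1], whereas [comulH] expands [sigma]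
   and then [nabla] first. The two exchanges move the second [Delta] sum past both. *)
rewrite [RHS]exchange_tsum.
etransitivity; [lift_tsum | apply: eq_tsum => ? ?].
rewrite [RHS]exchange_tsum.
do 3 (etransitivity; [lift_tsum | apply: eq_tsum => ? ?]).
by rewrite /tinl /tinr !tens_mul ?(mul1r, mulr1) ?mulrA.
Qed.

(** Compose the factorization [dcc_comulE] with the algebra map [conv id f g], which restricts to
    [f] and [g] on the two copies of [M ⊗ H]. *)
Lemma conv_comul (R : algType k) (f g : T -> R) :
  alg_hom f -> alg_hom g -> comm_maps f g ->
  conv comul f g =
  conv id (comulM (f \o tinl) (f \o tinr) (g \o tinl))
    (comulH (f \o tinl) (f \o tinr) (g \o tinl) (g \o tinr)).
Proof.
move=> hf hg fg; have hc : alg_hom (conv id f g) by solve_hom.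
rewrite conv_idE dcc_comulE comp_conv // comp_comulM // comp_comulH //.
have El (X : Type) (a : X -> T) : conv id f g \o (tinl \o a) = f \o a.
  by rewrite compA conv_tinl ?(alg_hom1 hg) //; solve_hom.
have Er (X : Type) (a : X -> T) : conv id f g \o (tinr \o a) = g \o a.
  by rewrite compA conv_tinr ?(alg_hom1 hf) //; solve_hom.
by rewrite !El !Er.
Qed.

Lemma alg_hom_comulM (R : algType k) (m1 : M -> R) (h1 : H -> R) (m2 : M -> R) :
  alg_hom m1 -> alg_hom h1 -> alg_hom m2 ->
  comm_maps m1 h1 -> comm_maps m1 m2 -> comm_maps h1 m2 ->
  alg_hom (comulM m1 h1 m2).
Proof. by move=> *; rewrite /comulM; solve_hom. Qed.

(** The algebra map induced by [f] and [g] preserves commutation. With [nabla], [btri] or [delta],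
    [sigma] for [s], [t], this carries conditions 9 and 10 into any algebra. *)
Lemma comm_conv2 (A B X Y R : algType k) (s : X -> A ⊗ B) (t : Y -> A ⊗ B)
    (f : A -> R) (g : B -> R) :
  comm_maps s t -> alg_hom f -> alg_hom g -> comm_maps f g ->
  comm_maps (conv s f g) (conv t f g).
Proof.
move=> st hf hg fg; rewrite 2!(conv_idE _ f); apply: comm_maps_comp => //; solve_hom.
Qed.

Lemma comulM1 (R : algType k) (m1 : M -> R) (h1 : H -> R) (m2 : M -> R) :
  alg_hom m1 -> alg_hom h1 -> alg_hom m2 -> comulM m1 h1 m2 1 = 1.
Proof.
move=> hm1 hh1 hm2; rewrite /comulM.
do !(apply: conv1; try solve_hom; try exact: alg_hom1).
Qed.

Lemma comulH1 (R : algType k) (m1 : M -> R) (h1 : H -> R)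
    (m2 : M -> R) (h2 : H -> R) :
  alg_hom m1 -> alg_hom h1 -> alg_hom m2 -> alg_hom h2 -> comulH m1 h1 m2 h2 1 = 1.
Proof.
move=> hm1 hh1 hm2 hh2; rewrite /comulH.
do !(apply: conv1; try solve_hom; try exact: alg_hom1).
Qed.

Lemma comul_tinl (R : algType k) (f g : T -> R) :
  alg_hom f -> alg_hom g -> comm_maps f g ->
  conv comul f g \o tinl = comulM (f \o tinl) (f \o tinr) (g \o tinl).
Proof.
move=> hf hg fg; rewrite conv_comul //; apply: conv_tinl.
- by rewrite /comulM; solve_hom.
- by rewrite /comulH; solve_hom.
- by apply: comulH1; solve_hom.
Qed.

Lemma comul_tinr (R : algType k) (f g : T -> R) :
  alg_hom f -> alg_hom g -> comm_maps f g ->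
  conv comul f g \o tinr = comulH (f \o tinl) (f \o tinr) (g \o tinl) (g \o tinr).
Proof.
move=> hf hg fg; rewrite conv_comul //; apply: conv_tinr.
- by rewrite /comulM; solve_hom.
- by rewrite /comulH; solve_hom.
- by apply: comulM1; solve_hom.
Qed.

(** Once [comul] is multiplicative, [conv comul f1 f2] is an algebra map, so [conv_comul] applies a
    second time. Coassociativity thereby splits into a part on [M] and a part on [H]. *)
Lemma conv_comul_left (R : algType k) (f1 f2 f3 : T -> R) :
  alg_hom comul -> alg_hom f1 -> alg_hom f2 -> alg_hom f3 ->
  comm_maps f1 f2 -> comm_maps f1 f3 -> comm_maps f2 f3 ->
  let A12 := comulM (f1 \o tinl) (f1 \o tinr) (f2 \o tinl) in
  let B12 := comulH (f1 \o tinl) (f1 \o tinr) (f2 \o tinl) (f2 \o tinr) in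
  conv comul (conv comul f1 f2) f3 =
  conv id (comulM A12 B12 (f3 \o tinl)) (comulH A12 B12 (f3 \o tinl) (f3 \o tinr)).
Proof.
move=> hcomul hf1 hf2 hf3 f12 f13 f23 /=.
by rewrite conv_comul ?comul_tinl ?comul_tinr //; solve_hom.
Qed.

Lemma conv_comul_right (R : algType k) (f1 f2 f3 : T -> R) :
  alg_hom comul -> alg_hom f1 -> alg_hom f2 -> alg_hom f3 ->
  comm_maps f1 f2 -> comm_maps f1 f3 -> comm_maps f2 f3 ->
  let A23 := comulM (f2 \o tinl) (f2 \o tinr) (f3 \o tinl) in
  let B23 := comulH (f2 \o tinl) (f2 \o tinr) (f3 \o tinl) (f3 \o tinr) in
  conv comul f1 (conv comul f2 f3) =
  conv id (comulM (f1 \o tinl) (f1 \o tinr) A23)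
    (comulH (f1 \o tinl) (f1 \o tinr) A23 B23).
Proof.
move=> hcomul hf1 hf2 hf3 f12 f13 f23 /=.
by rewrite conv_comul ?comul_tinl ?comul_tinr //; solve_hom.
Qed.

Notation eM := (scalar_map _ eta).
Notation eH := (scalar_map _ eps).

(** * Deleting tensor factors with [eta] and [eps] *)

Section Collapse.
Variable R : algType k.

Lemma conv_nabla_eH (f : M -> R) : linear f -> conv nabla eH f = f.
Proof.
by move=> lf; apply/funext => x; rewrite conv_scalarl // (dcc_nabla_counit MH_pair).
Qed.

Lemma conv_nabla_eM (f : H -> R) : alg_hom f -> conv nabla f eM = eM.
Proof.
move=> hf; apply/funext => x; rewrite conv_scalarr; last by solve_hom.
rewrite (dcc_nabla_eta MH_pair) (linear_scalar _ _ (alg_hom_linear hf)).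
by rewrite (alg_hom1 hf).
Qed.

Lemma conv_btri_eM (f : H -> R) : linear f -> conv btri f eM = f.
Proof.
by move=> lf; apply/funext => x; rewrite conv_scalarr // (dcc_btri_eta MH_pair).
Qed.

Lemma conv_btri_eH (f : M -> R) : alg_hom f -> conv btri eH f = eH.
Proof.
move=> hf; apply/funext => x; rewrite conv_scalarl; last by solve_hom.
rewrite (dcc_btri_counit MH_pair) (linear_scalar _ _ (alg_hom_linear hf)).
by rewrite (alg_hom1 hf).
Qed.

Lemma conv_Delta_eHl (f : H -> R) : linear f -> conv Delta eH f = f.
Proof.
move=> lf; apply/funext => x; rewrite conv_scalarl //.
by rewrite (bialg_counitl (dcc_bialgebra MH_pair)).
Qed.

Lemma conv_Delta_eHr (f : H -> R) : linear f -> conv Delta f eH = f.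
Proof.
move=> lf; apply/funext => x; rewrite conv_scalarr //.
by rewrite (bialg_counitr (dcc_bialgebra MH_pair)).
Qed.

End Collapse.

(** The counit is by definition the convolution of [eta] and [eps] in [k^o]. *)
Lemma scalar_counit (R : algType k) :
  scalar_map R (dcc_counit eps eta) = conv id (scalar_map R eta) (scalar_map R eps).
Proof. exact: (comp_conv _ _ _ (alg_hom_scalar R)). Qed.

Lemma alg_hom_counit : alg_hom (dcc_counit eps eta).
Proof.
apply: (@alg_hom_conv_id k M H _ eta eps) => // x h; exact: mulrC.
Qed.

Lemma scalar_counit_tinl (R : algType k) :
  scalar_map R (dcc_counit eps eta) \o tinl = scalar_map R eta.
Proof. by rewrite scalar_counit alg_hom_conv_tinl //; solve_hom. Qed.

Lemma scalar_counit_tinr (R : algType k) :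
  scalar_map R (dcc_counit eps eta) \o tinr = scalar_map R eps.
Proof. by rewrite scalar_counit alg_hom_conv_tinr //; solve_hom. Qed.

(** The axioms of the pair remove [nabla] and [btri]. Only [delta] and [sigma] with [eta] on the
    left remain, so the left counit law is governed by the left halves of conditions 1 and 2. *)
Lemma conv_comul_counitl (R : algType k) (f : T -> R) : alg_hom f ->
  conv comul (scalar_map R (dcc_counit eps eta)) f =
  conv id (conv delta eM (f \o tinl))
    (conv Delta (conv sigma eM (f \o tinl)) (f \o tinr)).
Proof.
move=> hf; have hcounit := alg_hom_counit.
have hs : alg_hom (scalar_map R (dcc_counit eps eta)) by solve_hom.
rewrite conv_comul //; last by solve_hom.
rewrite scalar_counit_tinl scalar_counit_tinr /comulM /comulH.
by rewrite !(conv_nabla_eH, conv_btri_eH, conv_Delta_eHl) //; solve_hom.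
Qed.

Lemma conv_comul_counitr (R : algType k) (f : T -> R) : alg_hom f ->
  conv comul f (scalar_map R (dcc_counit eps eta)) =
  conv id (conv delta (f \o tinl) eM)
    (conv Delta (conv sigma (f \o tinl) eM) (f \o tinr)).
Proof.
move=> hf; have hcounit := alg_hom_counit.
have hs : alg_hom (scalar_map R (dcc_counit eps eta)) by solve_hom.
rewrite conv_comul //; last by solve_hom.
rewrite scalar_counit_tinl scalar_counit_tinr /comulM /comulH.
by rewrite !(conv_nabla_eM, conv_btri_eM, conv_Delta_eHr) //; solve_hom.
Qed.

(** * Counit laws from conditions 1 and 2 *)

Section Counital.
Hypothesis counit_delta : forall x : M,
     \tsum_(x1 ⊗ x2 <- delta x) (eta x1 *: x2) = x /\
     \tsum_(x1 ⊗ x2 <- delta x) (eta x2 *: x1) = x.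
Hypothesis counit_sigma : forall h : H,
     \tsum_(y ⊗ z <- sigma h) (eta y *: z) = eps h *: 1 /\
     \tsum_(y ⊗ z <- sigma h) (eta z *: y) = eps h *: 1.

Lemma conv_delta_eMl (R : algType k) (f : M -> R) : linear f -> conv delta eM f = f.
Proof.
move=> lf; apply/funext => x; rewrite conv_scalarl //.
by case: (counit_delta x) => ->.
Qed.

Lemma conv_delta_eMr (R : algType k) (f : M -> R) : linear f -> conv delta f eM = f.
Proof.
move=> lf; apply/funext => x; rewrite conv_scalarr //.
by case: (counit_delta x) => _ ->.
Qed.

Lemma conv_sigma_eMl (R : algType k) (f : M -> R) : alg_hom f -> conv sigma eM f = eH.
Proof.
move=> hf; apply/funext => h; rewrite conv_scalarl; last by solve_hom.
case: (counit_sigma h) => -> _; rewrite (linear_scalar _ _ (alg_hom_linear hf)).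
by rewrite (alg_hom1 hf).
Qed.

Lemma conv_sigma_eMr (R : algType k) (f : M -> R) : alg_hom f -> conv sigma f eM = eH.
Proof.
move=> hf; apply/funext => h; rewrite conv_scalarr; last by solve_hom.
case: (counit_sigma h) => _ ->; rewrite (linear_scalar _ _ (alg_hom_linear hf)).
by rewrite (alg_hom1 hf).
Qed.

Lemma dcc_counitl (t : T) : \tsum_(a ⊗ b <- comul t) (dcc_counit eps eta a *: b) = t.
Proof.
rewrite -[LHS](conv_scalarl comul _ _ (f := id)) // conv_comul_counitl //.
have hl := @alg_hom_tinl k M H; have hr := @alg_hom_tinr k M H.
have idE X Y (g : X -> Y) : id \o g = g by [].
rewrite !idE conv_delta_eMl; last by solve_hom.
rewrite conv_sigma_eMl // conv_Delta_eHl; last by solve_hom.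
by rewrite conv_tinl_tinr.
Qed.

Lemma dcc_counitr (t : T) : \tsum_(a ⊗ b <- comul t) (dcc_counit eps eta b *: a) = t.
Proof.
rewrite -[LHS](conv_scalarr comul _ _ (f := id)) // conv_comul_counitr //.
have hl := @alg_hom_tinl k M H; have hr := @alg_hom_tinr k M H.
have idE X Y (g : X -> Y) : id \o g = g by [].
rewrite !idE conv_delta_eMr; last by solve_hom.
rewrite conv_sigma_eMr // conv_Delta_eHl; last by solve_hom.
by rewrite conv_tinl_tinr.
Qed.

End Counital.

(** * Sufficiency: multiplicativity and coassociativity *)

Section Sufficiency.
Hypothesis c9 : comm_maps nabla btri.
Hypothesis c10 : comm_maps delta sigma.

(** The factors coming from [sigma] and from [btri] both land in the slots [h1] and [m2]; condition
    9 makes them commute there. *)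
Lemma alg_hom_comulH (R : algType k) (m1 : M -> R) (h1 : H -> R)
    (m2 : M -> R) (h2 : H -> R) :
  alg_hom m1 -> alg_hom h1 -> alg_hom m2 -> alg_hom h2 ->
  comm_maps m1 h1 -> comm_maps m1 m2 -> comm_maps m1 h2 ->
  comm_maps h1 m2 -> comm_maps h1 h2 -> comm_maps m2 h2 ->
  alg_hom (comulH m1 h1 m2 h2).
Proof.
move=> *; have c : comm_maps (conv nabla h1 m2) (conv btri h1 m2) by exact: comm_conv2.
rewrite /comulH; solve_hom.
Qed.

(** Condition 10 lets the restriction to [M] pass the [sigma] factor of [comulH], and condition 9
    lets it pass the [btri] factor. *)
Lemma comm_comulM_comulH (R : algType k) (m1 : M -> R) (h1 : H -> R)
    (m2 : M -> R) (h2 : H -> R) :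
  alg_hom m1 -> alg_hom h1 -> alg_hom m2 -> alg_hom h2 ->
  comm_maps m1 h1 -> comm_maps m1 m2 -> comm_maps m1 h2 ->
  comm_maps h1 m2 -> comm_maps h1 h2 -> comm_maps m2 h2 ->
  comm_maps (comulM m1 h1 m2) (comulH m1 h1 m2 h2).
Proof.
move=> *; have c : comm_maps (conv nabla h1 m2) (conv btri h1 m2) by exact: comm_conv2.
have c' : comm_maps (conv delta m1 (conv nabla h1 m2)) (conv sigma m1 (conv nabla h1 m2)).
  by apply: comm_conv2 => //; solve_hom.
rewrite /comulM /comulH; solve_hom.
Qed.

Lemma alg_hom_dcc_comul : alg_hom comul.
Proof.
rewrite dcc_comulE; apply: alg_hom_conv_id.
- apply: alg_hom_comulM; solve_hom.
- apply: alg_hom_comulH; solve_hom.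
- apply: comm_comulM_comulH; solve_hom.
Qed.

Hypothesis c3 : form3 Delta nabla (@in1 k H H M) (@in2 k H H M) (@in3 k H H M).
Hypothesis c4 : form4 nabla delta sigma (@in1 k M M M) (@in2 k M M M) (@in3 k M M M).
Hypothesis c5 : form5 nabla btri delta (@in1 k H M M) (@in2 k H M M) (@in3 k H M M).
Hypothesis c6 : form6 Delta nabla btri delta sigma
  (@in1 k M M M) (@in2 k M M M) (@in3 k M M M).
Hypothesis c7 : form7 Delta nabla btri delta sigma
  (@in1 k H M M) (@in2 k H M M) (@in3 k H M M).
Hypothesis c8 : form8 Delta nabla btri (@in1 k H H M) (@in2 k H H M) (@in3 k H H M).

Section Slots.
Variables (R : algType k) (m1 m2 m3 : M -> R) (h1 h2 h3 : H -> R).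
Hypotheses (hm1 : alg_hom m1) (hm2 : alg_hom m2) (hm3 : alg_hom m3).
Hypotheses (hh1 : alg_hom h1) (hh2 : alg_hom h2) (hh3 : alg_hom h3).
Hypotheses (m1h1 : comm_maps m1 h1) (m1m2 : comm_maps m1 m2) (m1h2 : comm_maps m1 h2).
Hypotheses (m1m3 : comm_maps m1 m3) (h1m2 : comm_maps h1 m2) (h1h2 : comm_maps h1 h2).
Hypotheses (h1m3 : comm_maps h1 m3) (m2h2 : comm_maps m2 h2) (m2m3 : comm_maps m2 m3).
Hypotheses (h2m3 : comm_maps h2 m3) (h1h3 : comm_maps h1 h3) (m2h3 : comm_maps m2 h3).
Hypotheses (h2h3 : comm_maps h2 h3) (m3h3 : comm_maps m3 h3) (m1h3 : comm_maps m1 h3).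

(** Blocks shared by the two sides of coassociativity. Condition 3 is used at [P], [h2], [m3];
    conditions 4 and 6 at [m1], [N], [K]; conditions 5 and 7 at [h1], [m2], [g]; condition 8 at [P],
    [h2], [m3] and at [S], [V], [m3]. *)
Let N := conv nabla h1 m2.
Let P := conv btri h1 m2.
Let g := conv nabla h2 m3.
Let K := conv nabla P g.
Let V := conv Delta P h2.
Let S := conv sigma m1 N.

Let hN : alg_hom N. Proof. by rewrite /N; solve_hom. Qed.
Let hP : alg_hom P. Proof. by rewrite /P; solve_hom. Qed.
Let hg : alg_hom g. Proof. by rewrite /g; solve_hom. Qed.
Let Pg : comm_maps P g. Proof. by rewrite /P /g; solve_hom. Qed.
Let hK : alg_hom K. Proof. by rewrite /K; solve_hom. Qed.
Let Ph2 : comm_maps P h2. Proof. by rewrite /P; solve_hom. Qed.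
Let Pm3 : comm_maps P m3. Proof. by rewrite /P; solve_hom. Qed.
Let hV : alg_hom V. Proof. by rewrite /V; solve_hom. Qed.
Let Vm3 : comm_maps V m3. Proof. by rewrite /V; solve_hom. Qed.
Let NP : comm_maps N P. Proof. by rewrite /N /P; apply: comm_conv2. Qed.
Let m1N : comm_maps m1 N. Proof. by rewrite /N; solve_hom. Qed.
Let m1P : comm_maps m1 P. Proof. by rewrite /P; solve_hom. Qed.
Let m1g : comm_maps m1 g. Proof. by rewrite /g; solve_hom. Qed.
Let m1K : comm_maps m1 K. Proof. by rewrite /K; solve_hom. Qed.
Let Ng : comm_maps N g. Proof. by rewrite /N /g; solve_hom. Qed.
Let NK : comm_maps N K. Proof. by rewrite /K; solve_hom. Qed.
Let hS : alg_hom S. Proof. by rewrite /S; solve_hom. Qed.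
Let h1g : comm_maps h1 g. Proof. by rewrite /g; solve_hom. Qed.
Let m2g : comm_maps m2 g. Proof. by rewrite /g; solve_hom. Qed.
Let Nh2 : comm_maps N h2. Proof. by rewrite /N; solve_hom. Qed.
Let Nm3 : comm_maps N m3. Proof. by rewrite /N; solve_hom. Qed.
Let NV : comm_maps N V. Proof. by rewrite /V; solve_hom. Qed.
Let m1V : comm_maps m1 V. Proof. by rewrite /V; solve_hom. Qed.
Let SV : comm_maps S V. Proof. by rewrite /S; solve_hom. Qed.
Let Sm3 : comm_maps S m3. Proof. by rewrite /S; solve_hom. Qed.

Let K_V : K = conv nabla V m3.
Proof. by symmetry; exact: transport3. Qed.

(** Here [comulH m1 h1 m2 h2] is [conv Delta S V], so condition 3 splits it and [K_V] recognizes the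
    inner factor. *)
Let nabla_comulH : conv nabla (comulH m1 h1 m2 h2) m3 = conv nabla S K.
Proof.
rewrite K_V; apply: conv_coassoc; try solve_hom.
exact/form3P.
Qed.

(** Condition 5 turns the right side into [conv delta m1 (conv delta N K)], and condition 4
    rebrackets this into the left side. *)
Lemma coassocM :
  comulM (comulM m1 h1 m2) (comulH m1 h1 m2 h2) m3 =
  comulM m1 h1 (comulM m2 h2 m3).
Proof.
rewrite {1}/comulM nabla_comulH [RHS]/comulM /comulM -/g.
rewrite (transport5 c5 hh1 hm2 hg h1m2 h1g m2g) -/N -/P -/K.
by rewrite (transport4 c4 hm1 hN hK m1N m1K NK).
Qed.

Lemma coassocH :
  comulH (comulM m1 h1 m2) (comulH m1 h1 m2 h2) m3 h3 =
  comulH m1 h1 (comulM m2 h2 m3) (comulH m2 h2 m3 h3).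
Proof.
have coassoc (f1 f2 f3 : H -> R) : linear f1 -> linear f2 -> linear f3 ->
    conv Delta (conv Delta f1 f2) f3 = conv Delta f1 (conv Delta f2 f3).
  by apply: conv_coassoc; case: MH_pair => -[].
pose W := conv btri V m3; pose P' := conv btri h2 m3.
have lW : linear W by rewrite /W; solve_hom.
have lP' : linear P' by rewrite /P'; solve_hom.
have c7' := transport7 c7 hh1 hm2 hg h1m2 h1g m2g.
have c8' := transport8 c8 hP hh2 hm3 Ph2 Pm3 h2m3.
have c6' := transport6 c6 hm1 hN hK m1N m1K NK.
(* The common form: conditions 8 and 6, read backwards, bring the left side to it, and conditions 5,
   7 and 8 bring the right side. *)
transitivity (conv Delta (conv sigma m1 (conv delta N K))
    (conv Delta (conv sigma N K) (conv Delta W h3))).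
  have -> : comulH (comulM m1 h1 m2) (comulH m1 h1 m2 h2) m3 h3 =
      conv Delta (conv sigma (conv delta m1 N) (conv nabla S K))
        (conv Delta (conv Delta (conv btri S K) W) h3).
    rewrite {1}/comulH nabla_comulH; congr (conv _ _ (conv _ _ _)).
    (* Condition 8 backwards splits [conv btri (conv Delta S V) m3]. *)
    by rewrite K_V (transport8 c8 hS hV hm3 SV Sm3 Vm3).
  rewrite [conv Delta (conv Delta _ W) h3]coassoc; try solve_hom.
  rewrite -[LHS]coassoc; try solve_hom.
  by rewrite -c6' coassoc //; solve_hom.
have -> : comulH m1 h1 (comulM m2 h2 m3) (comulH m2 h2 m3 h3) =
    conv Delta (conv sigma m1 (conv delta N K))
      (conv Delta (conv btri h1 (conv delta m2 g))
        (conv Delta (conv sigma m2 g) (conv Delta P' h3))).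
  rewrite {1}/comulH; congr (conv _ (conv _ _ _) _).
  exact: (transport5 c5 hh1 hm2 hg h1m2 h1g m2g).
congr (conv _ _ _).
(* Regrouping brings the first two factors together for condition 7, which leaves [conv btri P g]
   next to [P']; condition 8 then merges these into [W]. *)
rewrite -[RHS]coassoc; try solve_hom.
rewrite c7' [RHS]coassoc; try solve_hom.
congr (conv _ _ _).
by rewrite -coassoc; try solve_hom; rewrite c8'.
Qed.

End Slots.

Lemma conv_comul_assoc (R : algType k) (f1 f2 f3 : T -> R) :
  alg_hom f1 -> alg_hom f2 -> alg_hom f3 ->
  comm_maps f1 f2 -> comm_maps f1 f3 -> comm_maps f2 f3 ->
  conv comul (conv comul f1 f2) f3 = conv comul f1 (conv comul f2 f3).
Proof.
have comm2 (X Y Z Z' : algType k) (f : X -> R) (g : Y -> R) (a : Z -> X) (b : Z' -> Y) :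
    comm_maps f g -> comm_maps (f \o a) (g \o b) by move=> fg z z'; exact: fg.
have hcomul := alg_hom_dcc_comul.
move=> hf1 hf2 hf3 c12 c13 c23.
rewrite (conv_comul_left hcomul hf1 hf2 hf3 c12 c13 c23).
rewrite (conv_comul_right hcomul hf1 hf2 hf3 c12 c13 c23).
rewrite coassocM ?coassocH //; first [exact: comm2 | solve_hom].
Qed.

Lemma dcc_comul_coassoc (t : T) :
    \tsum_(a ⊗ b <- comul t) \tsum_(a1 ⊗ a2 <- comul a) (a1 ⊗ a2 ⊗ b) =
    \tsum_(a ⊗ b <- comul t) \tsum_(b1 ⊗ b2 <- comul b) (a ⊗ b1 ⊗ b2).
Proof.
move: t; apply/coassocP; apply: conv_comul_assoc.
- exact: alg_hom_in1.
- exact: alg_hom_in2.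
- exact: alg_hom_in3.
- exact: comm_in12.
- exact: comm_in13.
- exact: comm_in23.
Qed.

End Sufficiency.

(** * Necessity: recovering the conditions from the bialgebra axioms *)

Section Necessity.
Hypothesis bialg : is_bialgebra comul (dcc_counit eps eta).
Let hcomul : alg_hom comul. Proof. by case: bialg. Qed.

(** Project the left counit law to [M] by applying [eps] to the factor [H]. Its restrictions to [M]
    and to [H] are the two identities. *)
Lemma counit_delta_sigma_l (x : M) (h : H) :
  \tsum_(x1 ⊗ x2 <- delta x) (eta x1 *: x2) = x /\
  \tsum_(y ⊗ z <- sigma h) (eta y *: z) = eps h *: 1.
Proof.
pose f : T -> M := conv id id eH.
have hf : alg_hom f by rewrite /f; solve_hom.
have fl : f \o tinl = id by
  exact: alg_hom_conv_tinl (alg_hom_id M) (alg_hom_scalar_map M heps).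
have fr : f \o tinr = eH by
  exact: alg_hom_conv_tinr (alg_hom_id M) (alg_hom_scalar_map M heps).
have E : conv comul (scalar_map M (dcc_counit eps eta)) f = f.
  apply/funext => t; rewrite conv_scalarl; last by solve_hom.
  by rewrite (bialg_counitl bialg).
rewrite conv_comul_counitl // fl fr conv_Delta_eHr in E; last by solve_hom.
have El := congr1 (fun F => F \o tinl) E; have Er := congr1 (fun F => F \o tinr) E.
rewrite fl alg_hom_conv_tinl in El; try solve_hom.
rewrite fr alg_hom_conv_tinr in Er; try solve_hom.
by split; rewrite -[LHS](conv_scalarl _ _ _ (f := id)) // ?El ?Er.
Qed.

Lemma counit_delta_sigma_r (x : M) (h : H) :
  \tsum_(x1 ⊗ x2 <- delta x) (eta x2 *: x1) = x /\
  \tsum_(y ⊗ z <- sigma h) (eta z *: y) = eps h *: 1.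
Proof.
pose f : T -> M := conv id id eH.
have hf : alg_hom f by rewrite /f; solve_hom.
have fl : f \o tinl = id by
  exact: alg_hom_conv_tinl (alg_hom_id M) (alg_hom_scalar_map M heps).
have fr : f \o tinr = eH by
  exact: alg_hom_conv_tinr (alg_hom_id M) (alg_hom_scalar_map M heps).
have E : conv comul f (scalar_map M (dcc_counit eps eta)) = f.
  apply/funext => t; rewrite conv_scalarr; last by solve_hom.
  by rewrite (bialg_counitr bialg).
rewrite conv_comul_counitr // fl fr conv_Delta_eHr in E; last by solve_hom.
have El := congr1 (fun F => F \o tinl) E; have Er := congr1 (fun F => F \o tinr) E.
rewrite fl alg_hom_conv_tinl in El; try solve_hom.
rewrite fr alg_hom_conv_tinr in Er; try solve_hom.
by split; rewrite -[LHS](conv_scalarr _ _ _ (f := id)) // ?El ?Er.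
Qed.

Let counit_delta (x : M) :
  \tsum_(x1 ⊗ x2 <- delta x) (eta x1 *: x2) = x /\
  \tsum_(x1 ⊗ x2 <- delta x) (eta x2 *: x1) = x.
Proof.
(* The value [0] fills the argument of the identity about [sigma], which is discarded. *)
by split; [case: (counit_delta_sigma_l x 0) | case: (counit_delta_sigma_r x 0)].
Qed.

Let counit_sigma (h : H) :
  \tsum_(y ⊗ z <- sigma h) (eta y *: z) = eps h *: 1 /\
  \tsum_(y ⊗ z <- sigma h) (eta z *: y) = eps h *: 1.
Proof.
by split; [case: (counit_delta_sigma_l 0 h) | case: (counit_delta_sigma_r 0 h)].
Qed.

(** The two factors commute inside [M ⊗ H], and the algebra map [conv comul f g] preserves this; its
    restrictions to them are [comulM] and [comulH]. *)
Lemma comm_comulM_comulH_of_hom (R : algType k) (m1 m2 : M -> R) (h1 h2 : H -> R) :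
  alg_hom m1 -> alg_hom h1 -> alg_hom m2 -> alg_hom h2 ->
  comm_maps m1 h1 -> comm_maps m1 m2 -> comm_maps m1 h2 ->
  comm_maps h1 m2 -> comm_maps h1 h2 -> comm_maps m2 h2 ->
  comm_maps (comulM m1 h1 m2) (comulH m1 h1 m2 h2).
Proof.
move=> *; pose f := conv id m1 h1; pose g := conv id m2 h2.
have hf : alg_hom f by rewrite /f; solve_hom.
have hg : alg_hom g by rewrite /g; solve_hom.
have fg : comm_maps f g by rewrite /f /g; solve_hom.
have hc : alg_hom (conv comul f g) by solve_hom.
have := comm_maps_comp hc (@comm_tinl_tinr k M H).
rewrite comul_tinl // comul_tinr //.
by rewrite /f /g !alg_hom_conv_tinl ?alg_hom_conv_tinr.
Qed.

(* Mapping factors by eM or eH deletes them, which is how each condition is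
   isolated from coassociativity below. *)
Lemma coassoc_of_bialgebra (R : algType k) (m1 m2 m3 : M -> R) (h1 h2 h3 : H -> R) :
  alg_hom m1 -> alg_hom h1 -> alg_hom m2 -> alg_hom h2 -> alg_hom m3 -> alg_hom h3 ->
  comm_maps m1 h1 -> comm_maps m1 m2 -> comm_maps m1 h2 -> comm_maps m1 m3 ->
  comm_maps m1 h3 -> comm_maps h1 m2 -> comm_maps h1 h2 -> comm_maps h1 m3 ->
  comm_maps h1 h3 -> comm_maps m2 h2 -> comm_maps m2 m3 -> comm_maps m2 h3 ->
  comm_maps h2 m3 -> comm_maps h2 h3 -> comm_maps m3 h3 ->
  comulM (comulM m1 h1 m2) (comulH m1 h1 m2 h2) m3 =
    comulM m1 h1 (comulM m2 h2 m3) /\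
  comulH (comulM m1 h1 m2) (comulH m1 h1 m2 h2) m3 h3 =
    comulH m1 h1 (comulM m2 h2 m3) (comulH m2 h2 m3 h3).
Proof.
move=> *; pose f1 := conv id m1 h1; pose f2 := conv id m2 h2; pose f3 := conv id m3 h3.
have hf1 : alg_hom f1 by rewrite /f1; solve_hom.
have hf2 : alg_hom f2 by rewrite /f2; solve_hom.
have hf3 : alg_hom f3 by rewrite /f3; solve_hom.
have f12 : comm_maps f1 f2 by rewrite /f1 /f2; solve_hom.
have f13 : comm_maps f1 f3 by rewrite /f1 /f3; solve_hom.
have f23 : comm_maps f2 f3 by rewrite /f2 /f3; solve_hom.
have E : conv comul (conv comul f1 f2) f3 = conv comul f1 (conv comul f2 f3).
  by apply: conv_coassoc; [exact: bialg_coassoc bialg | exact: alg_hom_linear..].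
have h12 : alg_hom (conv comul f1 f2) by solve_hom.
have h23 : alg_hom (conv comul f2 f3) by solve_hom.
have c123 : comm_maps (conv comul f1 f2) f3 by solve_hom.
have c123' : comm_maps f1 (conv comul f2 f3) by solve_hom.
(* Restriction to the two factors of the source separates coassociativity into the two claims. *)
have := congr1 (fun F => F \o tinl) E; have := congr1 (fun F => F \o tinr) E.
rewrite !comul_tinl // !comul_tinr // !comul_tinl //.
by rewrite /f1 /f2 /f3 !alg_hom_conv_tinl ?alg_hom_conv_tinr.
Qed.

Ltac collapse :=
  rewrite /comulM /comulH !(conv_nabla_eH, conv_nabla_eM, conv_btri_eH, conv_btri_eM,
    conv_Delta_eHl, conv_Delta_eHr, conv_delta_eMl counit_delta,
    conv_delta_eMr counit_delta, conv_sigma_eMl counit_sigma,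
    conv_sigma_eMr counit_sigma).

(** With the outer slots [m1] and [h2] deleted, [comulM] becomes [nabla] and [comulH] becomes
    [btri]. *)
Lemma comm_nabla_btri : comm_maps nabla btri.
Proof.
have := @comm_comulM_comulH_of_hom _ eM (@tinr k H M) (@tinl k H M) eH.
collapse; try solve_hom.
by rewrite !conv_tensE; apply; solve_hom.
Qed.

(** With both [H] slots deleted, [comulM] becomes [delta] and [comulH] becomes [sigma]. *)
Lemma comm_delta_sigma : comm_maps delta sigma.
Proof.
have := @comm_comulM_comulH_of_hom _ (@tinl k M M) (@tinr k M M) eH eH.
collapse; try solve_hom.
by rewrite !conv_tensE; apply; solve_hom.
Qed.

(** Three choices of surviving slots give all six conditions: [h1], [h2], [m3] give 3 and 8; [m1],
    [m2], [m3] give 4 and 6; [h1], [m2], [m3] give 5 and 7. In each pair the first comes from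
    coassociativity on [M], the second from that on [H]. *)
Lemma form3_of_bialgebra : form3 Delta nabla (@in1 k H H M) in2 in3.
Proof.
case: (@coassoc_of_bialgebra _ eM eM (@in3 k H H M) (@in1 k H H M) (@in2 k H H M) eH);
  try solve_hom.
move=> + _; collapse; try solve_hom.
exact.
Qed.

Lemma form4_of_bialgebra : form4 nabla delta sigma (@in1 k M M M) in2 in3.
Proof.
case: (@coassoc_of_bialgebra _ (@in1 k M M M) (@in2 k M M M) (@in3 k M M M) eH eH eH);
  try solve_hom.
move=> + _; collapse; try solve_hom.
exact.
Qed.

Lemma form5_of_bialgebra : form5 nabla btri delta (@in1 k H M M) in2 in3.
Proof.
case: (@coassoc_of_bialgebra _ eM (@in2 k H M M) (@in3 k H M M) (@in1 k H M M) eH eH);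
  try solve_hom.
move=> + _; collapse; try solve_hom.
exact.
Qed.

Lemma form6_of_bialgebra : form6 Delta nabla btri delta sigma (@in1 k M M M) in2 in3.
Proof.
case: (@coassoc_of_bialgebra _ (@in1 k M M M) (@in2 k M M M) (@in3 k M M M) eH eH eH);
  try solve_hom.
move=> _; collapse; try solve_hom.
exact.
Qed.

Lemma form7_of_bialgebra : form7 Delta nabla btri delta sigma (@in1 k H M M) in2 in3.
Proof.
case: (@coassoc_of_bialgebra _ eM (@in2 k H M M) (@in3 k H M M) (@in1 k H M M) eH eH);
  try solve_hom.
move=> _; collapse; try solve_hom.
exact.
Qed.

Lemma form8_of_bialgebra : form8 Delta nabla btri (@in1 k H H M) in2 in3.
Proof.
case: (@coassoc_of_bialgebra _ eM eM (@in3 k H H M) (@in1 k H H M) (@in2 k H H M) eH);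
  try solve_hom.
move=> _; collapse; try solve_hom.
exact.
Qed.

End Necessity.
End Pair.

(** * Conditions 9 and 10 as commutation, and the equivalence *)

Lemma tsum_tens_mul (k : fieldType) (A B : algType k) (s t : A ⊗ B) :
  \tsum_(a ⊗ b <- s) \tsum_(c ⊗ d <- t) (a * c ⊗ b * d) = s * t.
Proof. by []. Qed.

Lemma tsum_tens_mulC (k : fieldType) (A B : algType k) (s t : A ⊗ B) :
  \tsum_(a ⊗ b <- s) \tsum_(c ⊗ d <- t) (c * a ⊗ d * b) = t * s.
Proof. by rewrite exchange_tsum. Qed.

Theorem proposition3p3 (k : fieldType) (M H : algType k)
    (Delta : H -> H ⊗ H) (eps : H -> k^o) (eta : M -> k^o)
    (nabla : M -> H ⊗ M) (btri : H -> H ⊗ M)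
    (delta : M -> M ⊗ M) (sigma : H -> M ⊗ M)
    (MH_pair : cocycle_dcc_pair Delta eps eta nabla btri delta sigma) :
  @is_bialgebra k (tensor M H)
    (dcc_comul Delta nabla btri delta sigma) (dcc_counit eps eta)
  <->
  (forall x : M,
     \tsum_(x1 ⊗ x2 <- delta x) (eta x1 *: x2) = x /\
     \tsum_(x1 ⊗ x2 <- delta x) (eta x2 *: x1) = x) /\
  (forall h : H,
     \tsum_(y ⊗ z <- sigma h) (eta y *: z) = eps h *: 1 /\
     \tsum_(y ⊗ z <- sigma h) (eta z *: y) = eps h *: 1) /\
  is_left_comodule Delta eps nabla /\
  (forall x : M,
     \tsum_(x1 ⊗ x2 <- delta x) \tsum_(x21 ⊗ x22 <- delta x2)
       (x1 ⊗ x21 ⊗ x22) =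
     \tsum_(x1 ⊗ x2 <- delta x) \tsum_(x11 ⊗ x12 <- delta x1)
     \tsum_(x2m ⊗ x20 <- nabla x2) \tsum_(y ⊗ z <- sigma x2m)
       (x11 * y ⊗ x12 * z ⊗ x20)) /\
  (forall x : M,
     \tsum_(xm ⊗ x0 <- nabla x) \tsum_(x01 ⊗ x02 <- delta x0)
       (xm ⊗ x01 ⊗ x02) =
     \tsum_(x1 ⊗ x2 <- delta x) \tsum_(x1m ⊗ x10 <- nabla x1)
     \tsum_(x2m ⊗ x20 <- nabla x2) \tsum_(u ⊗ v <- btri x2m)
       (x1m * u ⊗ x10 * v ⊗ x20)) /\
  (forall h : H,
     \tsum_(h1 ⊗ h2 <- Delta h)
     \tsum_(y ⊗ z <- sigma h1) \tsum_(z1 ⊗ z2 <- delta z)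
     \tsum_(y' ⊗ z' <- sigma h2)
       (y ⊗ z1 * y' ⊗ z2 * z') =
     \tsum_(h1 ⊗ h2 <- Delta h)
     \tsum_(y ⊗ z <- sigma h1) \tsum_(y1 ⊗ y2 <- delta y)
     \tsum_(zm ⊗ z0 <- nabla z) \tsum_(p ⊗ q <- sigma zm)
     \tsum_(u ⊗ v <- btri h2) \tsum_(r ⊗ s <- sigma u)
       (y1 * p * r ⊗ y2 * q * s ⊗ z0 * v)) /\
  (forall h : H,
     \tsum_(h1 ⊗ h2 <- Delta h)
     \tsum_(u ⊗ v <- btri h1) \tsum_(v1 ⊗ v2 <- delta v)
     \tsum_(y ⊗ z <- sigma h2)
       (u ⊗ v1 * y ⊗ v2 * z) =
     \tsum_(h1 ⊗ h2 <- Delta h)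
     \tsum_(y ⊗ z <- sigma h1) \tsum_(ym ⊗ y0 <- nabla y)
     \tsum_(zm ⊗ z0 <- nabla z) \tsum_(p ⊗ q <- btri zm)
     \tsum_(u ⊗ v <- btri h2) \tsum_(r ⊗ s <- btri u)
       (ym * p * r ⊗ y0 * q * s ⊗ z0 * v)) /\
  (forall h : H,
     \tsum_(h1 ⊗ h2 <- Delta h)
     \tsum_(u ⊗ v <- btri h1) \tsum_(vm ⊗ v0 <- nabla v)
     \tsum_(u' ⊗ v' <- btri h2)
       (u ⊗ vm * u' ⊗ v0 * v') =
     \tsum_(u ⊗ v <- btri h) \tsum_(u1 ⊗ u2 <- Delta u)
       (u1 ⊗ u2 ⊗ v)) /\
  (forall (x : M) (h : H),
     \tsum_(xm ⊗ x0 <- nabla x) \tsum_(u ⊗ v <- btri h)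
       (xm * u ⊗ x0 * v) =
     \tsum_(xm ⊗ x0 <- nabla x) \tsum_(u ⊗ v <- btri h)
       (u * xm ⊗ v * x0)) /\
  (forall (x : M) (h : H),
     \tsum_(y ⊗ z <- sigma h) \tsum_(x1 ⊗ x2 <- delta x)
       (y * x1 ⊗ z * x2) =
     \tsum_(y ⊗ z <- sigma h) \tsum_(x1 ⊗ x2 <- delta x)
       (x1 * y ⊗ x2 * z)).
Proof.
have hDelta := bialg_comul_hom (dcc_bialgebra MH_pair).
have hnabla := dcc_nabla_hom MH_pair.
split.
  move=> bialg.
  have counitl x h := counit_delta_sigma_l MH_pair bialg x h.
  have counitr x h := counit_delta_sigma_r MH_pair bialg x h.
  split; first by move=> x; split; [case: (counitl x 0) | case: (counitr x 0)].
  split; first by move=> h; split; [case: (counitl 0 h) | case: (counitr 0 h)].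
  split; first split.
  - exact: alg_hom_linear.
  - exact/form3P/(form3_of_bialgebra MH_pair bialg).
  - exact: dcc_nabla_counit MH_pair.
  split; first exact/form4P/(form4_of_bialgebra MH_pair bialg).
  split; first exact/form5P/(form5_of_bialgebra MH_pair bialg).
  split; first exact/form6P/(form6_of_bialgebra MH_pair bialg).
  split; first exact/form7P/(form7_of_bialgebra MH_pair bialg).
  split; first exact/form8P/(form8_of_bialgebra MH_pair bialg).
  (* The double sums are by definition products in a tensor product algebra, so conditions 9 and 10
     say that the values of two maps commute. *)
  split=> x h; rewrite tsum_tens_mul tsum_tens_mulC.
    exact: (comm_nabla_btri MH_pair bialg).
  by rewrite (comm_delta_sigma MH_pair bialg).
move=> [counit_delta [counit_sigma [[_ /form3P c3 _] [/form4P c4 [/form5P c5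
  [/form6P c6 [/form7P c7 [/form8P c8 [c9 c10]]]]]]]]].
have {}c9 : comm_maps nabla btri.
  by move=> x h; have := c9 x h; rewrite tsum_tens_mul tsum_tens_mulC.
have {}c10 : comm_maps delta sigma.
  by move=> x h; have := c10 x h; rewrite tsum_tens_mul tsum_tens_mulC => ->.
split.
- exact: (alg_hom_dcc_comul MH_pair).
- exact: (alg_hom_counit MH_pair).
- exact: (dcc_comul_coassoc MH_pair).
- exact: (dcc_counitl MH_pair).
- exact: (dcc_counitr MH_pair).
Qed.
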